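(* Let $A,B$ be normal $n\times n$ complex matrices and let $f:[0,\infty)\to[0,\infty)$ be concave. Then for every symmetric norm $\|\cdot\|$ on $n\times n$ matrices, $$\|\, f(|A+B|)\,\| \le \|\, f(|A|)+f(|B|)\,\|.$$
   Context: For a matrix $X$, $|X|=(X^*X)^{1/2}$, and $f(|X|)$ is defined by the functional calculus for the positive semi-definite matrix $|X|$. A symmetric (unitarily invariant) norm is a norm on $n\times n$ matrices satisfying $\|UXV\|=\|X\|$ for all matrices $X$ and all unitaries $U,V$. *)

(* Defs.v *)
From HB Require Import structures.
From mathcomp Require Import all_boot all_order all_algebra.
From mathcomp Require Import boolp reals.
From mathcomp.real_closed Require Import complex.

Set Implicit Arguments.
Unset Strict Implicit.
Unset Printing Implicit Defensive.

Import Order.TTheory GRing.Theory Num.Theory.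
Local Open Scope ring_scope.
Local Open Scope complex_scope.
Local Open Scope sesquilinear_scope.

Section MatFun.
Variables (R : realType) (n : nat).
Local Notation C := R[i].

Definition spec_decomp (P : 'M[C]_n) (Ud : 'M[C]_n * 'rV[R]_n) : Prop :=
  Ud.1 \is unitarymx /\
  P = Ud.1 ^t* *m diag_mx (map_mx (fun x : R => x%:C) Ud.2) *m Ud.1.

(* Functional calculus f(P) for a Hermitian matrix P and f : R -> R:
   f(P) = U^* diag(f(d)) U for a (chosen) spectral decomposition of P.
   (Independent of the choice; set to 0 for non-Hermitian P, never used.) *)
Definition mfun (f : R -> R) (P : 'M[C]_n) : 'M[C]_n :=
  match pselect (exists Ud, spec_decomp P Ud) with
  | left h => let Ud := projT1 (cid h) in
      Ud.1 ^t* *m diag_mx (map_mx (fun x : R => (f x)%:C) Ud.2) *m Ud.1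
  | right _ => 0
  end.

Definition absmx (X : 'M[C]_n) : 'M[C]_n := mfun Num.sqrt (X ^t* *m X).

Definition symmetric_norm (N : 'M[C]_n -> R) : Prop :=
  [/\ forall X, 0 <= N X,
      forall X, N X = 0 -> X = 0,
      forall (a : C) X, (N (a *: X))%:C = `|a| * (N X)%:C,
      forall X Y, N (X + Y) <= N X + N Y
    & forall X (U V : 'M[C]_n), U \is unitarymx -> V \is unitarymx ->
        N (U *m X *m V) = N X].

End MatFun.

(* f : [0,oo) -> [0,oo) concave (only values on [0,oo) matter). *)
Definition nonneg_concave (R : realType) (f : R -> R) : Prop :=
  (forall x, 0 <= x -> 0 <= f x) /\
  (forall x y t, 0 <= x -> 0 <= y -> 0 <= t -> t <= 1 ->
     t * f x + (1 - t) * f y <= f (t * x + (1 - t) * y)).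

(* Main.v *)
Require Import Defs.
From HB Require Import structures.
From mathcomp Require Import all_boot all_order all_algebra.
From mathcomp Require Import boolp reals.
From mathcomp Require Import perm ring lra.
From mathcomp.real_closed Require Import complex.

Set Implicit Arguments.
Unset Strict Implicit.
Unset Printing Implicit Defensive.

Import Order.TTheory GRing.Theory Num.Theory.
Local Open Scope ring_scope.
Local Open Scope sesquilinear_scope.

(** By Ky Fan's dominance principle it suffices to bound, for every [m], the sum of the
    [m] largest eigenvalues of [f(|A+B|)] by that of [f(|A|)+f(|B|)]; subtracting [f(0)]
    we may assume [f(0) = 0].

    Positive case.  Let [S = A+B] with [A, B >= 0], and let [E] be the spectral projection
    onto its [m] top eigenvectors.  Then [tr E f(S) <= tr E (f(A)+f(B))]: both sides are
    linear in [f], and on the finitely many eigenvalues involved [f] is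
    [lambda t - sum_j c_j (t-p_j)_+] with [c_j >= 0], so only [(t-c)_+] matters.  Put
    [P = (A-c)_+], [Q = (B-c)_+], [T = P+Q].  Then [A >= P + c pi_P] with [pi_P] the
    support projection of [P], and [pi_P >= P^1/2 T^+ P^1/2].  A Chebyshev-type rearrangement
    shows that on the top [k <= rank T] eigenvectors of [T] the operator
    [P^1/2 T^+ P^1/2 + Q^1/2 T^+ Q^1/2] has trace at least [k], whence the sum of the [k]
    top eigenvalues of [T] plus [c k] is at most that of [S].

    Normal case.  For normal [A] the positive part of [[0, A], [A^*, 0]] is
    [1/2 [[|A|, A], [A^*, |A|]]], whose nonzero eigenvalues are those of [|A|].  With
    [S = 1/2 [[|A|+|B|, A+B], [(A+B)^*, |A|+|B|]]], Weyl's inequality bounds the singular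
    values of [A+B] by the eigenvalues of [S]; the positive case applies to [S], and the
    resulting [2n x 2n] Gram matrix [1/2 [[Z, Y], [Y^*, Z]]], [Z = f(|A|)+f(|B|)], has
    Ky Fan norms at most those of [Z]. *)

(** * Concave functions and weak majorization *)

Section Concave.
Variable R : realType.
Implicit Types (f : R -> R).

Definition concave_nneg f := forall x y t, 0 <= x -> 0 <= y -> 0 <= t -> t <= 1 ->
  t * f x + (1 - t) * f y <= f (t * x + (1 - t) * y).

(** A drop between [x] and [y] would continue by concavity and make [f] negative far to the
    right. *)
Lemma nonneg_concave_homo f : nonneg_concave f ->
  forall x y, 0 <= x -> x <= y -> f x <= f y.
Proof.
move=> [f0 fc] x y x0 xy; rewrite leNgt; apply/negP => fxy.
have y0 := le_trans x0 xy.
have fy0 := f0 y y0; have fx0 : 0 < f x by lra.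
(* Below, [y] is the convex combination of [x] and [z] with weight [d] on [z]; this [d] makes
   [(1 - d) * f x] the mean of [f x] and [f y], which exceeds [f y]. *)
pose d := (f x - f y) / (2 * f x).
have d0 : 0 < d by apply: divr_gt0; lra.
have dE : d * f x = (f x - f y) / 2 by rewrite /d; field; rewrite gt_eqF.
have d1 : d <= 1 by rewrite -(ler_pM2r fx0) dE; lra.
pose z := x + (y - x) / d.
have z0 : 0 <= z by rewrite addr_ge0 // divr_ge0 ?subr_ge0 // ltW.
have := fc x z (1 - d) x0 z0; rewrite subr_ge0 gerBl => /(_ d1 (ltW d0)).
have -> : (1 - d) * x + (1 - (1 - d)) * z = y by rewrite /z; field; rewrite gt_eqF.
have dz : 0 <= (1 - (1 - d)) * f z by rewrite mulr_ge0 ?f0 //; lra.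
by rewrite mulrBl dE; lra.
Qed.

(** Since [b] lies between [a] and [t], concavity at [b] keeps [f t] below the continued chord. *)
Lemma concave_extrapolation f a b t nu : concave_nneg f -> 0 <= a -> a < b -> b <= t ->
  f b = f a + nu * (b - a) -> f t <= f a + nu * (t - a).
Proof.
move=> fc a0 ab bt fb.
pose th := (b - a) / (t - a).
have ta : 0 < t - a by lra.
have th0 : 0 < th by apply: divr_gt0; lra.
have th1 : th <= 1 by rewrite ler_pdivrMr //; lra.
have := fc t a th (ltac:(lra)) a0 (ltW th0) th1.
have -> : th * t + (1 - th) * a = b by rewrite /th; field; rewrite gt_eqF.
rewrite fb => h; rewrite -(ler_pM2l th0).
have -> : th * (f a + nu * (t - a)) = th * f a + nu * (b - a).
  by rewrite /th; field; rewrite gt_eqF.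
by lra.
Qed.

(** Each pair [cp] is a drop of slope and the knot where it happens; nonnegative drops make the
    function concave. *)
Definition angles (lam : R) (s : seq (R * R)) (t : R) : R :=
  lam * t - \sum_(cp <- s) cp.1 * Num.max (t - cp.2) 0.

(** Points are added from left to right. The last clause is the induction invariant: past the last
    point the interpolant is affine and dominates [f], so the next slope drop is nonnegative. *)
Lemma concave_interpolation_sorted f (ps : seq R) :
  concave_nneg f -> f 0 = 0 -> path <%R 0 ps ->
  exists lam s, [/\ all (fun cp => (0 <= cp.1) && (0 <= cp.2)) s,
    {in 0 :: ps, forall t, f t = angles lam s t} &
    ps != [::] -> exists mu, forall t, last 0 ps <= t ->
       angles lam s t = f (last 0 ps) + mu * (t - last 0 ps) /\ f t <= angles lam s t].
Proof.
move=> fc f0; elim/last_ind: ps => [|ps p IH].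
  move=> _; exists 0, [::]; split=> // t; rewrite inE => /eqP ->.
  by rewrite f0 /angles big_nil mul0r subr0.
rewrite rcons_path => /andP[pth lp]; have [lam [s [s0 es]]] := IH pth.
have l0 : 0 <= last 0 ps.
  have := order_path_min lt_trans pth; case/lastP: (ps) => // qs q.
  by rewrite all_rcons last_rcons => /andP[/ltW].
have [ps0 _|psn0] := eqVneq ps [::].
  move: lp; rewrite ps0 /= => p0; exists (f p / p), [::]; split=> //.
    move=> t; rewrite /angles big_nil subr0 !inE => /orP[] /eqP ->.
      by rewrite f0 mulr0.
    by rewrite divfK // gt_eqF.
  move=> _; exists (f p / p) => t pt; rewrite /angles big_nil subr0; split.
    by field; rewrite gt_eqF.
  have := @concave_extrapolation f 0 p t (f p / p) fc (lexx _) p0 pt.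
  by rewrite f0 !add0r !subr0; apply; rewrite divfK // gt_eqF.
move=> /(_ isT) [mu hmu]; set l := last 0 ps in l0 lp hmu *.
have [qp fqp] := hmu p (ltW lp).
have pl : 0 < p - l by rewrite subr_gt0.
(* The slope drop at the previous point [l] that brings the interpolant down to [f p] at [p]. *)
pose c := (angles lam s p - f p) / (p - l).
have c0 : 0 <= c by rewrite divr_ge0 ?subr_ge0 // ltW.
have cE : c * (p - l) = angles lam s p - f p by rewrite /c divfK // gt_eqF.
have aE t : angles lam ((c, l) :: s) t = angles lam s t - c * Num.max (t - l) 0.
  by rewrite /angles big_cons /= opprD addrCA addrC -addrA addrC.
have aE1 t : l <= t -> angles lam ((c, l) :: s) t = angles lam s t - c * (t - l).
  by move=> lt_; rewrite aE max_l // subr_ge0.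
exists lam, ((c, l) :: s); split.
- by rewrite /= c0 l0.
- move=> t; rewrite -rcons_cons mem_rcons in_cons => /orP[/eqP->|tin].
    by rewrite aE1 ?(ltW lp) // cE; lra.
  have tl : t <= l.
    move: pth; rewrite lt_path_sortedE => /andP[/allP hall srt].
    move: tin; rewrite in_cons => /orP[/eqP->//|tin].
    have : sorted <=%R ps by apply: sub_sorted srt => ? ? /ltW.
    move: tin l0 (psn0); rewrite /l; case/lastP: (ps) => // qs q.
    rewrite last_rcons mem_rcons in_cons => /orP[/eqP->//|tq] _ _.
    rewrite -cats1 sorted_pairwise; last exact: le_trans.
    by rewrite pairwise_cat => /and3P[/allrelP h _ _]; apply: h; rewrite ?inE.
  by rewrite aE max_r ?subr_le0 // mulr0 subr0 es.
- move=> _; rewrite last_rcons; exists (mu - c) => t pt.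
  have fl : angles lam ((c, l) :: s) t = f l + (mu - c) * (t - l).
    by rewrite aE1 ?(le_trans (ltW lp)) // (hmu t _).1 ?(le_trans (ltW lp)) //; ring.
  have fp : f p = f l + (mu - c) * (p - l).
    by rewrite mulrBl cE qp; lra.
  split; first by rewrite fl fp; ring.
  by rewrite fl; apply: (concave_extrapolation (b := p)).
Qed.

Lemma concave_interpolation (I : finType) f (t : I -> R) :
  concave_nneg f -> f 0 = 0 -> (forall k, 0 <= t k) ->
  exists lam s, all (fun cp => (0 <= cp.1) && (0 <= cp.2)) s /\
    forall k, f (t k) = angles lam s (t k).
Proof.
move=> fc f0 t0.
pose ps := sort <=%R (undup [seq t k | k <- enum I & 0 < t k]).
have pth : path <%R 0 ps.
  rewrite lt_path_sortedE; apply/andP; split.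
    by apply/allP => x; rewrite mem_sort mem_undup => /mapP[k]; rewrite mem_filter => /andP[h _] ->.
  by rewrite sort_lt_sorted undup_uniq.
have [lam [s [s0 h _]]] := concave_interpolation_sorted fc f0 pth.
exists lam, s; split=> // k; apply: h; rewrite in_cons mem_sort mem_undup.
have [//|tk] := eqVneq (t k) 0.
by rewrite /=; apply/map_f; rewrite mem_filter mem_enum andbT lt_def tk t0.
Qed.

(** After interpolation the sum is [lam] times a zero sum minus nonnegative multiples of the angle
    sums. *)
Lemma concave_sum_ge0 (I : finType) f (w t : I -> R) :
  concave_nneg f -> f 0 = 0 -> (forall k, 0 <= t k) ->
  \sum_k w k * t k = 0 ->
  (forall p, 0 <= p -> \sum_k w k * Num.max (t k - p) 0 <= 0) ->
  0 <= \sum_k w k * f (t k).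
Proof.
move=> fc f0 t0 wt wp.
have [lam [s [/allP s0 fE]]] := concave_interpolation fc f0 t0.
have -> : \sum_k w k * f (t k) =
   lam * (\sum_k w k * t k) -
   \sum_(cp <- s) cp.1 * (\sum_k w k * Num.max (t k - cp.2) 0).
  rewrite mulr_sumr.
  under [X in _ - X]eq_bigr do rewrite mulr_sumr.
  rewrite [X in _ - X]exchange_big /= -sumrB; apply: eq_bigr => k _.
  rewrite fE /angles mulrBr mulr_sumr mulrCA; congr (_ - _).
  by apply: eq_bigr => cp _; rewrite mulrCA.
rewrite wt mulr0 sub0r oppr_ge0 big_seq; apply: sumr_le0 => cp /s0 /andP[c0 p0].
by rewrite mulr_ge0_le0 // wp.
Qed.

End Concave.

(** * Weak majorization and functions monotone under it *)

Section Majorization.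
Variables (R : realType) (n : nat).
Implicit Types (x y : 'I_n -> R) (m : nat).

Definition decreasing_fun x := forall i j : 'I_n, (i <= j)%N -> x j <= x i.

Definition top_sum m y : R := \sum_(i < n | (i < m)%N) y i.

Lemma weighted_sum_le_top m y (w : 'I_n -> R) :
  decreasing_fun y -> (forall i, 0 <= y i) -> (forall i, 0 <= w i <= 1) ->
  \sum_i w i <= m%:R -> \sum_i w i * y i <= top_sum m y.
Proof.
move=> yd y0 w01 wm.
have [nm|mn] := leqP n m.
  rewrite [leRHS](eq_bigl predT) => [|i]; last by rewrite /= (leq_trans (ltn_ord i) nm).
  by apply: ler_sum => i _; have /andP[_ w1] := w01 i; rewrite ler_piMl.
(* [tau] is the first value outside the top [m]. Trading weight at this price bounds each term, and
   the total correction, [tau] times the total weight minus [m], is nonpositive. *)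
pose tau := y (Ordinal mn).
have key i : w i * y i <= (if (i < m)%N then y i else 0) + tau * (w i - (i < m)%N%:R).
  have /andP[w0 w1] := w01 i; case: ltnP => im /=.
    have : tau <= y i by apply: yd; rewrite ltnW.
    by move=> h; have := mulr_ge0 (ltac:(lra) : 0 <= 1 - w i) (ltac:(lra) : 0 <= y i - tau); lra.
  have : y i <= tau by apply: yd.
  by move=> h; have := mulr_ge0 w0 (ltac:(lra) : 0 <= tau - y i); rewrite add0r subr0; lra.
apply: (le_trans (ler_sum _ (fun i _ => key i))).
rewrite big_split /= -big_mkcond /= gerDl -mulr_sumr mulr_ge0_le0 ?y0 //.
rewrite sumrB subr_le0; apply: (le_trans wm).
have -> : \sum_(i < n) (i < m)%N%:R = \sum_(i < n | (i < m)%N) (1 : R).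
  by rewrite [RHS]big_mkcond; apply: eq_bigr => i _; case: ltnP.
rewrite -(big_ord_widen n (fun=> 1) (ltnW mn)).
by rewrite sumr_const card_ord.
Qed.

Definition weakly_majorized x y := forall m, top_sum m x <= top_sum m y.

Definition upd x i (a : R) : 'I_n -> R := fun k => if k == i then a else x k.

Lemma top_sum_upd m x i a :
  top_sum m (upd x i a) = top_sum m x + (if (i < m)%N then a - x i else 0).
Proof.
rewrite /top_sum; case: ltnP => im /=.
  rewrite !(bigD1 i im) /= {1}/upd eqxx.
  rewrite (eq_bigr x) => [|k /andP[_ /negPf ki]]; last by rewrite /upd ki.
  by ring.
rewrite addr0; apply: eq_bigr => k km; rewrite /upd; case: eqP => // ki.
by move: km; rewrite ki ltnNge im.
Qed.

(* Hardy-Littlewood-Polya: every step moves [y] towards [x] by a Robin Hood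
   transfer between two coordinates, or shrinks one coordinate, and makes one more
   coordinate of [y] agree with [x]. *)
Lemma gauge_weakly_majorized (phi : ('I_n -> R) -> R) :
  (forall y j k a b, j != k -> y k <= a <= y j -> a + b = y j + y k ->
     phi (upd (upd y j b) k a) <= phi y) ->
  (forall y i a, 0 <= a <= y i -> phi (upd y i a) <= phi y) ->
  forall x y, decreasing_fun x -> (forall i, 0 <= x i) ->
    weakly_majorized x y -> phi x <= phi y.
Proof.
move=> phiT phiS x y xd x0.
have [r] := ubnP #|[pred i | x i != y i]|.
elim: r y => // r IH y card_r xy.
have decr y' i : x i != y i -> y' i = x i -> (forall k, x k = y k -> y' k = x k) ->
    (#|[pred i | x i != y' i]| < r)%N.
  move=> xyi y'i hk; rewrite -ltnS; apply: leq_trans card_r; apply: proper_card.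
  apply/properP; split; last by exists i; rewrite inE ?xyi // y'i eqxx.
  by apply/subsetP => k; rewrite !inE; apply: contra => /eqP /hk ->.
have [/existsP[k0 hk0]|/existsPn xley] := boolP [exists k, y k < x k].
  have [k yk kmin] := @arg_minnP _ k0 [pred k | y k < x k] (@nat_of_ord n) hk0.
  rewrite /= in yk.
  have xley (i : 'I_n) : (i < k)%N -> x i <= y i.
    by move=> ik; rewrite leNgt; apply/negP => /kmin; rewrite leqNgt ik.
  (* If no earlier coordinate of [y] exceeded that of [x], the sums of the first [k+1] coordinates
     would contradict majorization. *)
  have [j /andP[jk yj]] : exists j : 'I_n, (j < k)%N && (x j < y j).
    apply/existsP; apply: contraT => /existsPn h.
    have := xy k.+1; rewrite /top_sum !(bigD1 k (ltnSn k)) /=.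
    rewrite [X in _ + X <= _](eq_bigr y); first by rewrite lerD2r leNgt yk.
    move=> i /andP[ik nik]; have {ik nik} ik : (i < k)%N.
      by rewrite ltn_neqAle -ltnS ik andbT; apply: contra nik => /eqP/val_inj ->.
    by apply/eqP; rewrite eq_le xley //=; move: (h i); rewrite ik /= -leNgt.
  have njk : j != k by rewrite -val_eqE neq_ltn jk.
  have xjk : x k <= x j by apply: xd; apply: ltnW.
  (* The largest transfer from [j] to [k] that pushes neither coordinate past [x]; one of the two
     then agrees with [x]. *)
  pose d := Num.min (y j - x j) (x k - y k).
  have d0 : 0 < d by rewrite lt_min !subr_gt0 yj.
  have dj : d <= y j - x j by rewrite ge_min lexx.
  have dk : d <= x k - y k by rewrite ge_min lexx orbT.
  pose y' := upd (upd y j (y j - d)) k (y k + d).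
  have y'k : y' k = y k + d by rewrite /y' /upd eqxx.
  have y'j : y' j = y j - d by rewrite /y' /upd (negPf njk) eqxx.
  have y'i i : i != j -> i != k -> y' i = y i by rewrite /y' /upd => /negPf -> /negPf ->.
  apply: (@le_trans _ _ (phi y')); last by apply: phiT; [|lra|lra].
  apply: IH.
    have hagree i : x i = y i -> y' i = x i.
      move=> e; rewrite e; apply: y'i; apply/eqP => e'; move: e; rewrite e'; lra.
    have [e|e] : d = y j - x j \/ d = x k - y k.
      by rewrite /d minEle; case: ifP; [left|right].
      by apply: (decr y' j) => //; [rewrite lt_eqF|rewrite y'j; lra].
    by apply: (decr y' k) => //; [rewrite gt_eqF|rewrite y'k; lra].
  (* Only prefixes containing [j] but not [k] lose the mass [d]; there every [y i - x i] is
     nonnegative and the surplus at [j] alone pays for the loss. *)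
  move=> m; rewrite /y' !top_sum_upd [upd _ _ _ k]/upd [k == j]eq_sym (negPf njk).
  have [km|mk] := ltnP k m.
    by rewrite (ltn_trans jk km); have := xy m; lra.
  have [jm|mj] := ltnP j m; last by rewrite !addr0.
  have -> : top_sum m x = top_sum m y - \sum_(i < n | (i < m)%N) (y i - x i).
    by rewrite sumrB /top_sum; ring.
  have : y j - x j <= \sum_(i < n | (i < m)%N) (y i - x i).
    rewrite (bigD1 j jm) /= lerDl; apply: sumr_ge0 => i /andP[im _].
    by rewrite subr_ge0 xley // (leq_trans im).
  by lra.
have {}xley i : x i <= y i by rewrite leNgt xley.
have [/existsP[i xyi]|/existsPn h] := boolP [exists i, x i != y i]; last first.
  by rewrite (_ : x = y) //; apply/funext => i; apply/eqP; rewrite -[_ == _]negbK h.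
apply: (@le_trans _ _ (phi (upd y i (x i)))); last by apply: phiS; rewrite x0 xley.
apply: IH.
  by apply: (decr _ i) => //; [rewrite /upd eqxx|move=> k; rewrite /upd; case: eqP => // ->].
move=> m; apply: ler_sum => k _; rewrite /upd.
by case: eqP => [->|_].
Qed.

End Majorization.

(** * Positive matrices and the Ky Fan principle *)

(** [J] may be rectangular, since the dilation is an [n] by [n + n] matrix with orthonormal rows.
    The lock makes it unfold only through [cdiagE]. *)
HB.lock Definition cdiag (C : numClosedFieldType) m n (J : 'M[C]_(m, n))
    (d : 'I_m -> C) : 'M[C]_n :=
  J ^t* *m diag_mx (\row_i d i) *m J.

Section PositiveMatrices.
Variable C : numClosedFieldType.

Lemma adjmxM m n p (A : 'M[C]_(m, n)) (B : 'M_(n, p)) :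
  (A *m B) ^t* = B ^t* *m A ^t*.
Proof. by rewrite trmx_mul map_mxM. Qed.

Lemma adjmxD m n (A B : 'M[C]_(m, n)) : (A + B) ^t* = A ^t* + B ^t*.
Proof. by rewrite linearD map_mxD. Qed.

Lemma adjmxB m n (A B : 'M[C]_(m, n)) : (A - B) ^t* = A ^t* - B ^t*.
Proof. by rewrite linearB map_mxB. Qed.

Lemma adjmxZ m n a (A : 'M[C]_(m, n)) : (a *: A) ^t* = a^* *: A ^t*.
Proof. by rewrite linearZ map_mxZ. Qed.

Lemma adjmx1 n : (1%:M : 'M[C]_n) ^t* = 1%:M.
Proof. by rewrite trmx1 map_mx1. Qed.

Lemma adjmx_diag n (d : 'I_n -> C) :
  (diag_mx (\row_i d i)) ^t* = diag_mx (\row_i (d i)^*).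
Proof. by rewrite tr_diag_mx map_diag_mx; congr diag_mx; apply/rowP => i; rewrite !mxE. Qed.

Lemma adjmx_row m n1 n2 (A : 'M[C]_(m, n1)) (B : 'M_(m, n2)) :
  (row_mx A B) ^t* = col_mx (A ^t*) (B ^t*).
Proof. by rewrite tr_row_mx map_col_mx. Qed.

Lemma adjmx_col m1 m2 n (A : 'M[C]_(m1, n)) (B : 'M_(m2, n)) :
  (col_mx A B) ^t* = row_mx (A ^t*) (B ^t*).
Proof. by rewrite tr_col_mx map_row_mx. Qed.

Lemma unitarymxE n (U : 'M[C]_n) : U \is unitarymx -> U ^t* *m U = 1%:M.
Proof. by rewrite -trmxC_unitary => /unitarymxP; rewrite trmxCK. Qed.

Lemma adjmx_hermitianM n (A B : 'M[C]_n) : A ^t* = A -> B ^t* = B ->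
  (A *m B) ^t* = B *m A.
Proof. by rewrite adjmxM => -> ->. Qed.

Lemma adjmx_gram m n (A : 'M[C]_(m, n)) : (A ^t* *m A) ^t* = A ^t* *m A.
Proof. by rewrite adjmxM trmxCK. Qed.

Lemma adjmx_hermitian_congr m n (L : 'M[C]_(m, n)) (A : 'M_n) : A ^t* = A ->
  (L *m A *m L ^t*) ^t* = L *m A *m L ^t*.
Proof. by rewrite !adjmxM trmxCK => ->; rewrite mulmxA. Qed.

Lemma adjmx_hermitian_sandwich n (H A : 'M[C]_n) : H ^t* = H -> A ^t* = A ->
  (H *m A *m H) ^t* = H *m A *m H.
Proof. by rewrite !adjmxM => -> ->; rewrite mulmxA. Qed.

(** In the order of [C], [0 <= z] includes that [z] is real. *)
Record psd n (M : 'M[C]_n) : Prop :=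
  Psd { psd_form_ge0 : forall x : 'rV_n, 0 <= (x *m M *m x ^t*) 0 0 }.

Lemma psdD n (A B : 'M[C]_n) : psd A -> psd B -> psd (A + B).
Proof. by move=> [pA] [pB]; split=> x; rewrite mulmxDr mulmxDl mxE addr_ge0. Qed.

Lemma psdZ n a (A : 'M[C]_n) : 0 <= a -> psd A -> psd (a *: A).
Proof. by move=> a0 [pA]; split=> x; rewrite -scalemxAr -scalemxAl mxE mulr_ge0. Qed.

Lemma psd_congr m n (M : 'M[C]_n) (L : 'M_(m, n)) : psd M -> psd (L *m M *m L ^t*).
Proof. by move=> [pM]; split=> x; have := pM (x *m L); rewrite adjmxM !mulmxA. Qed.

Lemma psd1 n : psd (1%:M : 'M[C]_n).
Proof.
split=> x; rewrite mulmx1 mxE; apply: sumr_ge0 => i _.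
by rewrite !mxE mul_conjC_ge0.
Qed.

Lemma psd_gram m n (L : 'M[C]_(m, n)) : psd (L *m L ^t*).
Proof. by have := psd_congr L (@psd1 n); rewrite mulmx1. Qed.

Lemma psd_gramr m n (L : 'M[C]_(m, n)) : psd (L ^t* *m L).
Proof. by have := psd_gram (L ^t*); rewrite trmxCK. Qed.

Lemma psd_congrr m n (M : 'M[C]_m) (L : 'M_(m, n)) : psd M -> psd (L ^t* *m M *m L).
Proof. by move=> /(psd_congr (L ^t*)); rewrite trmxCK. Qed.

Lemma psd_entry_ge0 n (M : 'M[C]_n) i : psd M -> 0 <= M i i.
Proof.
move=> [/(_ (delta_mx 0 i))]; rewrite -rowE mxE (bigD1 i) //= big1 => [|j ji].
  by rewrite !mxE !eqxx conjC1 mulr1 addr0.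
by rewrite !mxE eqxx (negPf ji) conjC0 mulr0.
Qed.

Lemma cdiagE m n (J : 'M[C]_(m, n)) d :
  cdiag J d = J ^t* *m diag_mx (\row_i d i) *m J.
Proof. by rewrite unlock. Qed.

Section Cdiag.
Variables (m n : nat) (J : 'M[C]_(m, n)).
Implicit Types d e : 'I_m -> C.

Lemma eq_cdiag d e : d =1 e -> cdiag J d = cdiag J e.
Proof.
move=> de; rewrite !cdiagE; do 2!congr (_ *m _); congr diag_mx.
by apply/rowP => i; rewrite !mxE.
Qed.

Lemma cdiagD d e : cdiag J d + cdiag J e = cdiag J (fun i => d i + e i).
Proof.
rewrite !cdiagE -mulmxDl -mulmxDr -linearD; do 2!congr (_ *m _).
by congr diag_mx; apply/rowP => i; rewrite !mxE.
Qed.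

Lemma cdiagZ a d : a *: cdiag J d = cdiag J (fun i => a * d i).
Proof.
rewrite !cdiagE scalemxAl scalemxAr -linearZ; do 2!congr (_ *m _).
by congr diag_mx; apply/rowP => i; rewrite !mxE.
Qed.

Lemma cdiagB d e : cdiag J d - cdiag J e = cdiag J (fun i => d i - e i).
Proof.
rewrite -scaleN1r cdiagZ cdiagD; apply: eq_cdiag => i.
by rewrite mulN1r.
Qed.

Lemma cdiag_adj d : (cdiag J d) ^t* = cdiag J (fun i => (d i)^*).
Proof. by rewrite !cdiagE !adjmxM trmxCK adjmx_diag mulmxA. Qed.

Lemma cdiag_real_adj d : (forall i, d i \is Num.real) -> (cdiag J d) ^t* = cdiag J d.
Proof. by move=> dr; rewrite cdiag_adj; apply: eq_cdiag => i; exact/CrealP. Qed.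

Lemma cdiagM d e : J \is unitarymx ->
  cdiag J d *m cdiag J e = cdiag J (fun i => d i * e i).
Proof.
move=> /unitarymxP JJ; rewrite !cdiagE !mulmxA -[_ *m J *m J ^t*]mulmxA JJ mulmx1.
rewrite -[_ *m diag_mx _ *m diag_mx _]mulmxA mul_diag_mx; do 2!congr (_ *m _).
by apply/matrixP => i j; rewrite !mxE mulrnAr.
Qed.

Lemma cdiag_tr d (M : 'M_n) :
  \tr (cdiag J d *m M) = \sum_i d i * (J *m M *m J ^t*) i i.
Proof.
rewrite !cdiagE -!mulmxA mxtrace_mulC -!mulmxA mul_diag_mx !mulmxA.
by apply: eq_bigr => i _; rewrite !mxE.
Qed.

Lemma psd_cdiag d : (forall i, 0 <= d i) -> psd (cdiag J d).
Proof.
move=> d0; rewrite cdiagE; apply: psd_congrr; split=> x; rewrite mxE; apply: sumr_ge0 => i _.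
by rewrite mul_mx_diag !mxE mulrAC mulr_ge0 // mul_conjC_ge0.
Qed.

Lemma psd_tr_cdiag_ge0 d (M : 'M_n) :
  (forall i, 0 <= d i) -> psd M -> 0 <= \tr (cdiag J d *m M).
Proof.
move=> d0 pM; rewrite cdiag_tr; apply: sumr_ge0 => i _.
by rewrite mulr_ge0 //; apply/psd_entry_ge0/psd_congr.
Qed.

Lemma cdiag_mul p (K : 'M_(n, p)) d : cdiag (J *m K) d = K ^t* *m cdiag J d *m K.
Proof. by rewrite !cdiagE adjmxM !mulmxA. Qed.

Lemma cdiag_id d : J \is unitarymx -> J *m cdiag J d *m J ^t* = diag_mx (\row_i d i).
Proof.
move=> /unitarymxP JJ; rewrite !cdiagE !mulmxA JJ mul1mx -mulmxA JJ mulmx1 //.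
Qed.

End Cdiag.

Lemma cdiag_const n (U : 'M[C]_n) a : U \is unitarymx -> cdiag U (fun=> a) = a%:M.
Proof.
move=> uU; rewrite !cdiagE (_ : diag_mx _ = a%:M).
  by rewrite -mulmxA mul_scalar_mx -scalemxAr unitarymxE // scalemx1.
by rewrite -diag_const_mx; congr diag_mx; apply/rowP => i; rewrite !mxE.
Qed.

Lemma normal_cdiag n (A : 'M[C]_n) : A \is normalmx ->
  exists (U : 'M[C]_n) d, U \is unitarymx /\ A = cdiag U d.
Proof.
move=> /orthomx_spectralP AE; have uA := spectral_unitarymx A.
exists (spectralmx A), (fun i => spectral_diag A 0 i); split=> //.
rewrite cdiagE {1}AE invmx_unitary //; do 2!congr (_ *m _).
by congr diag_mx; apply/rowP => i; rewrite !mxE.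
Qed.

Lemma hermitian_cdiag n (A : 'M[C]_n) : A ^t* = A ->
  exists (U : 'M[C]_n) d, [/\ U \is unitarymx, forall i, d i \is Num.real & A = cdiag U d].
Proof.
move=> hA; have : A \is normalmx by apply/normalmxP; rewrite hA.
move=> /normal_cdiag [U [d [uU AE]]]; exists U, d; split=> // i.
move: hA; rewrite AE cdiag_adj => /(congr1 (fun M => (U *m M *m U ^t*) i i)).
by rewrite !cdiag_id // !mxE eqxx !mulr1n => /CrealP.
Qed.

Lemma hermitian_psd n (A : 'M[C]_n) (U : 'M_n) d : U \is unitarymx ->
  A = cdiag U d -> psd A -> forall i, 0 <= d i.
Proof.
move=> uU AE /(psd_congr U) /(psd_entry_ge0) h i; have := h i.
by rewrite AE cdiag_id // !mxE eqxx mulr1n.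
Qed.

Lemma hermitian_square_psd n (Y : 'M[C]_n) : Y ^t* = Y -> psd (Y *m Y).
Proof. by move=> {1}<-; apply: psd_gramr. Qed.

Lemma rank_cdiag n (U : 'M[C]_n) d : U \is unitarymx ->
  \rank (cdiag U d) = #|[pred i | d i != 0]|.
Proof.
move=> uU; have Uu := unitarymx_unit uU.
have -> : \rank (cdiag U d) = \rank (diag_mx (\row_i d i)).
  rewrite !cdiagE mxrankMfree ?row_free_unit // eqmxMfull // row_full_unit.
  by apply: unitarymx_unit; rewrite trmxC_unitary.
set S := [pred i | _]; set D := diag_mx _.
(* [K] selects the coordinates in the support [S]: [D = D K^T K] bounds the rank above,
   [K D D' K^T = 1] bounds it below. *)
pose K : 'M[C]_(#|S|, n) := \matrix_(a, b) (enum_val a == b)%:R.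
apply/eqP; rewrite eqn_leq; apply/andP; split.
  suff -> : D = D *m K^T *m K.
    exact: leq_trans (mxrankM_maxr _ _) (rank_leq_row _).
  rewrite -mulmxA mul_diag_mx; apply/matrixP => i j; rewrite !mxE.
  have [di|di] := eqVneq (d i) 0; first by rewrite di mul0r mul0rn.
  have iS : i \in S by rewrite inE.
  rewrite (bigD1 (enum_rank_in iS i)) //= !mxE enum_rankK_in // eqxx mul1r big1.
    by rewrite addr0 mulr_natr.
  move=> k ki; rewrite !mxE; case: eqP => [e|]; last by rewrite mul0r.
  by case/eqP: ki; apply: enum_val_inj; rewrite enum_rankK_in.
pose D' := diag_mx (\row_i (d i)^-1).
have : K *m D *m D' *m K^T = 1%:M.
  rewrite mul_mx_diag; apply/matrixP => a b; rewrite !mxE.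
  rewrite (bigD1 (enum_val a)) //= big1 => [|k ka]; last first.
    by rewrite mul_mx_diag !mxE eq_sym (negPf ka) !mul0r.
  rewrite mul_mx_diag !mxE eqxx mul1r mulfV; last by have := enum_valP a.
  by rewrite mul1r addr0 (inj_eq enum_val_inj) eq_sym.
move=> /(congr1 (fun M => \rank M)); rewrite mxrank1 => <-.
rewrite -!mulmxA; apply: leq_trans (mxrankM_maxr _ _) _.
exact: mxrankM_maxl.
Qed.

(** Test matrices for the Ky Fan sum of order [m]. The trace bound feeds the comparison with
    [top_sum]; the rank bound is what passes from [K K^*] to [K^* K]. *)
Definition contraction_rank n (m : nat) (G : 'M[C]_n) :=
  [/\ G ^t* = G, psd G, psd (1%:M - G), \tr G <= m%:R & (\rank G <= m)%N].

Lemma contraction_rank_proj n (U : 'M[C]_n) (S : pred 'I_n) m : U \is unitarymx ->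
  (#|S| <= m)%N -> contraction_rank m (cdiag U (fun i => (S i)%:R)).
Proof.
move=> uU Sm; split.
- by apply: cdiag_real_adj => i; rewrite realn.
- by apply: psd_cdiag => i; rewrite ler0n.
- rewrite -(cdiag_const _ uU) cdiagB; apply: psd_cdiag => i.
  by case: (S i); rewrite ?subrr // subr0 ler01.
- rewrite -[cdiag _ _]mulmx1 cdiag_tr mulmx1 (unitarymxP _) //.
  under eq_bigr do rewrite mxE eqxx mulr1.
  by rewrite -natr_sum ler_nat (leq_trans _ Sm) // -sum1_card [leqRHS]big_mkcond.
- rewrite rank_cdiag // (leq_trans _ Sm) //; apply: subset_leq_card.
  by apply/subsetP => i; rewrite !inE pnatr_eq0 eqb0 negbK.
Qed.

(* The support projection of [K^* G K] has rank at most [m] and captures its whole trace. *)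
Lemma contraction_rank_swap p q m (K : 'M[C]_(p, q)) (G : 'M[C]_p) :
  contraction_rank m G ->
  exists2 G' : 'M[C]_q, contraction_rank m G' &
    \tr (G *m (K *m K ^t*)) <= \tr (G' *m (K ^t* *m K)).
Proof.
move=> [hG pG p1G _ rG]; pose M := K ^t* *m G *m K.
have hM : M ^t* = M by rewrite /M !adjmxM trmxCK hG mulmxA.
have pM : psd M by apply: psd_congrr.
have [U [d [uU dr ME]]] := hermitian_cdiag hM.
pose S : pred 'I_q := fun i => d i != 0.
have Sm : (#|S| <= m)%N.
  rewrite -(rank_cdiag d uU) -ME; apply: leq_trans rG.
  by rewrite /M; apply: leq_trans (mxrankM_maxl _ _) (mxrankM_maxr _ _).
exists (cdiag U (fun i => (S i)%:R)); first exact: contraction_rank_proj.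
have -> : \tr (G *m (K *m K ^t*)) = \tr (cdiag U (fun i => (S i)%:R) *m M).
  rewrite mulmxA mxtrace_mulC mulmxA -/M {2}ME cdiagM // {1}ME; congr (\tr _).
  by apply: eq_cdiag => i; rewrite /S; case: eqP => [->|]; rewrite ?mulr0 ?mul1r.
rewrite -subr_ge0 -raddfB -mulmxBr; apply: psd_tr_cdiag_ge0.
  by move=> i; rewrite ler0n.
(* [G <= 1] gives [K^* G K <= K^* K]. *)
rewrite (_ : _ - M = K ^t* *m (1%:M - G) *m K); first exact: psd_congrr.
by rewrite mulmxBr mulmxBl mulmx1.
Qed.

End PositiveMatrices.

(** * Dilation of a normal matrix *)

Section Dilation.
Variables (C : numClosedFieldType) (n : nat).
Implicit Types (U V : 'M[C]_n) (ph d r : 'I_n -> C).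

Let h : C := sqrtC 2^-1.

Let hh : h * h = 2^-1.
Proof. by rewrite -expr2 sqrtCK. Qed.

Let hC : h^* = h.
Proof. by rewrite geC0_conj // sqrtC_ge0 invr_ge0 ler0n. Qed.

Let half2 (V : lmodType C) (x : V) : 2^-1 *: (x + x) = x.
Proof. by rewrite -mulr2n -scaler_nat scalerA mulVf ?scale1r // pnatr_eq0. Qed.

(** For [A = cdiag U (ph d)] with real [d], the rows are left eigenvectors of [[0, A], [A^*, 0]]
    with eigenvalues [d] when [ph] is unimodular; [- ph] gives the eigenvalues [- d]. *)
Definition dilation U ph : 'M[C]_(n, n + n) :=
  h *: row_mx (diag_mx (\row_i (ph i)^*) *m U) U.

Lemma diag_mul_gram U d : (diag_mx (\row_i d i) *m U) ^t* *m (diag_mx (\row_i d i) *m U) =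
  cdiag U (fun i => (d i)^* * d i).
Proof.
rewrite cdiagE adjmxM adjmx_diag mulmxA; congr (_ *m _).
rewrite -mulmxA mul_diag_mx; congr (_ *m _); apply/matrixP => i j.
by rewrite !mxE mulrnAr.
Qed.

Lemma dilation_unitary U ph : U \is unitarymx -> (forall i, ph i * (ph i)^* = 1) ->
  dilation U ph \is unitarymx.
Proof.
move=> /unitarymxP uU phu; apply/unitarymxP.
rewrite /dilation adjmxZ adjmx_row -scalemxAl -scalemxAr scalerA hC hh mul_row_col.
rewrite adjmxM adjmx_diag mulmxA -[_ *m U *m _]mulmxA uU mulmx1.
rewrite -[RHS]half2; congr (_ *: (_ + _)); rewrite mul_diag_mx.
by apply/matrixP => i j; rewrite !mxE conjCK mulrnAr mulrC phu.
Qed.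

Lemma cdiag_dilation U ph d : (forall i, ph i * (ph i)^* = 1) ->
  cdiag (dilation U ph) d = 2^-1 *: block_mx
    (cdiag U d) (cdiag U (fun i => ph i * d i))
    (cdiag U (fun i => (ph i)^* * d i)) (cdiag U d).
Proof.
move=> phu; rewrite cdiagE /dilation adjmxZ adjmx_row adjmxM adjmx_diag.
rewrite -!scalemxAl -scalemxAr scalerA hC hh; congr (_ *: _).
rewrite mul_col_mx mul_col_row; congr block_mx; rewrite cdiagE ?mulmxA; congr (_ *m _);
  rewrite -?mulmxA; congr (_ *m _); rewrite ?mul_diag_mx;
  apply/matrixP => i j; rewrite !mxE ?conjCK ?mulrnAr //.
- by rewrite mulrCA phu mulr1.
- by rewrite [d i * _]mulrC.
Qed.

(** For [d >= 0] this splits the Hermitian dilation into its positive and negative parts: the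
    diagonal blocks cancel and the others double. *)
Lemma cdiag_dilationB U ph d : (forall i, ph i * (ph i)^* = 1) ->
  cdiag (dilation U ph) d - cdiag (dilation U (fun i => - ph i)) d =
  block_mx 0 (cdiag U (fun i => ph i * d i)) (cdiag U (fun i => (ph i)^* * d i)) 0.
Proof.
move=> phu; rewrite !cdiag_dilation => [|i|//]; last by rewrite rmorphN mulrNN.
rewrite -scalerBr opp_block_mx add_block_mx !subrr !cdiagB scale_block_mx !scaler0.
have dbl (z : C) : 2^-1 * (z + z) = z.
  by rewrite -mulr2n -[z *+ 2]mulr_natl mulrA mulVf ?mul1r // pnatr_eq0.
congr block_mx; rewrite cdiagZ; apply: eq_cdiag => i; rewrite ?rmorphN mulNr opprK dbl //.
Qed.

(* [P = cdiag (dilation U ph) r^2 + ...] is a Gram matrix [(L1, L2)^* (L1, L2)]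
   with [L1^* L1 = L2^* L2 = Z / 2], hence [P] is equivalent to
   [L1 L1^* + L2 L2^*] and its Ky Fan norms are at most those of [Z]. *)
Lemma tr_dilation_le m U V ph ph' r r' (E : 'M[C]_(n + n)) (x : C) :
  (forall i, ph i * (ph i)^* = 1) -> (forall i, ph' i * (ph' i)^* = 1) ->
  (forall i, 0 <= r i) -> (forall i, 0 <= r' i) -> contraction_rank m E ->
  let Z := cdiag U (fun i => r i * r i) + cdiag V (fun i => r' i * r' i) in
  (forall G : 'M[C]_n, contraction_rank m G -> \tr (G *m Z) <= x) ->
  \tr (E *m (cdiag (dilation U ph) (fun i => r i * r i) +
             cdiag (dilation V ph') (fun i => r' i * r' i))) <= x.
Proof.
move=> phu phu' r0 r0' cE Z Zx.
have rC i : (r i)^* = r i by apply: geC0_conj.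
have rC' i : (r' i)^* = r' i by apply: geC0_conj.
pose L p p' : 'M[C]_(n + n, n) := h *: col_mx (diag_mx (\row_i (r i * p i)) *m U)
                        (diag_mx (\row_i (r' i * p' i)) *m V).
have LL p p' : (forall i, p i * (p i)^* = 1) -> (forall i, p' i * (p' i)^* = 1) ->
    (L p p') ^t* *m L p p' = 2^-1 *: Z.
  move=> pu pu'; rewrite /L adjmxZ adjmx_col -scalemxAl -scalemxAr scalerA hC hh.
  rewrite mul_row_col !diag_mul_gram; congr (_ *: (_ + _)); apply: eq_cdiag => i.
    by rewrite rmorphM /= rC mulrACA [_^* * _]mulrC pu mulr1.
  by rewrite rmorphM /= rC' mulrACA [_^* * _]mulrC pu' mulr1.
pose L1 := L (fun i => (ph i)^*) (fun i => (ph' i)^*); pose L2 := L (fun=> 1) (fun=> 1).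
have L1L1 : L1 ^t* *m L1 = 2^-1 *: Z by apply: LL => i; rewrite conjCK mulrC.
have L2L2 : L2 ^t* *m L2 = 2^-1 *: Z by apply: LL => i; rewrite conjC1 mulr1.
(* By block rows, [M] consists of the two scaled dilations, so [M^* M] is the matrix to be bounded;
   by block columns, [M M^* = L1 L1^* + L2 L2^*]. *)
pose M := row_mx L1 L2.
have ME : M = col_mx (diag_mx (\row_i r i) *m dilation U ph)
                     (diag_mx (\row_i r' i) *m dilation V ph').
  rewrite /M /L1 /L2 /L -scale_row_mx -block_mxEh block_mxEv scale_col_mx.
  by congr col_mx; rewrite /dilation -scalemxAr mul_mx_row; congr (_ *: row_mx _ _);
    rewrite ?mulmxA; congr (_ *m _); rewrite ?mul_diag_mx; apply/matrixP => i j;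
    rewrite !mxE ?mulr1 // mulrnAr.
have MM : M ^t* *m M = cdiag (dilation U ph) (fun i => r i * r i) +
             cdiag (dilation V ph') (fun i => r' i * r' i).
  rewrite ME adjmx_col mul_row_col; congr (_ + _); rewrite cdiagE adjmxM adjmx_diag mulmxA;
  congr (_ *m _); rewrite -mulmxA mul_diag_mx; congr (_ *m _); apply/matrixP => i j;
  by rewrite !mxE mulrnAr ?rC ?rC'.
have bound G' (K : 'M[C]_(n + n, n)) : contraction_rank m G' -> K ^t* *m K = 2^-1 *: Z ->
    \tr (G' *m (K *m K ^t*)) <= 2^-1 * x.
  move=> cG' KE; have [G cG le_G] := contraction_rank_swap K cG'.
  apply: le_trans le_G _; rewrite KE -scalemxAr mxtraceZ ler_wpM2l ?Zx //.
  by rewrite invr_ge0 ler0n.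
rewrite -MM; have [G cG le_G] := contraction_rank_swap (M ^t*) cE.
move: le_G; rewrite trmxCK => /le_trans; apply.
rewrite adjmx_row mul_row_col mulmxDr mxtraceD.
apply: le_trans (lerD (bound _ _ cG L1L1) (bound _ _ cG L2L2)) _.
rewrite -mulrDr; have := half2 (x : C^o); rewrite /GRing.scale /= => ->.
exact: lexx.
Qed.

End Dilation.

Local Open Scope complex_scope.

(** * Real spectra, Ky Fan sums and a rearrangement inequality *)

Section KyFan.
Variable R : realType.
Local Notation C := R[i].

Definition rcdiag m n (J : 'M[C]_(m, n)) (d : 'I_m -> R) : 'M[C]_n :=
  cdiag J (fun i => (d i)%:C).

Lemma eq_rcdiag m n (J : 'M[C]_(m, n)) d e : d =1 e -> rcdiag J d = rcdiag J e.
Proof. by move=> de; apply: eq_cdiag => i; rewrite de. Qed.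

Lemma rcdiag_adj m n (J : 'M[C]_(m, n)) d : (rcdiag J d) ^t* = rcdiag J d.
Proof. by apply: cdiag_real_adj => i; rewrite complex_real. Qed.

Lemma rcdiagD m n (J : 'M[C]_(m, n)) d e :
  rcdiag J d + rcdiag J e = rcdiag J (fun i => d i + e i).
Proof. by rewrite /rcdiag cdiagD; apply: eq_cdiag => i; rewrite rmorphD. Qed.

Lemma rcdiagB m n (J : 'M[C]_(m, n)) d e :
  rcdiag J d - rcdiag J e = rcdiag J (fun i => d i - e i).
Proof. by rewrite /rcdiag cdiagB; apply: eq_cdiag => i; rewrite rmorphB. Qed.

Lemma rcdiagZ m n (J : 'M[C]_(m, n)) a d :
  a%:C *: rcdiag J d = rcdiag J (fun i => a * d i).
Proof. by rewrite /rcdiag cdiagZ; apply: eq_cdiag => i; rewrite rmorphM. Qed.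

Lemma rcdiagM m n (J : 'M[C]_(m, n)) d e : J \is unitarymx ->
  rcdiag J d *m rcdiag J e = rcdiag J (fun i => d i * e i).
Proof. by move=> uJ; rewrite /rcdiag (cdiagM _ _ uJ); apply: eq_cdiag => i; rewrite -rmorphM. Qed.

Lemma psd_rcdiag m n (J : 'M[C]_(m, n)) d : (forall i, 0 <= d i) -> psd (rcdiag J d).
Proof. by move=> d0; apply: psd_cdiag => i; rewrite ler0c. Qed.

Lemma psd_rcdiag_ge0 n (U : 'M[C]_n) d : U \is unitarymx -> psd (rcdiag U d) ->
  forall i, 0 <= d i.
Proof. by move=> uU pU i; rewrite -ler0c; apply: (hermitian_psd uU (erefl _) pU). Qed.

Lemma decreasing_perm n (d : 'I_n -> R) : exists s : 'S_n, decreasing_fun (d \o s).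
Proof.
pose t := [tuple d i | i < n].
have /tuple_permP[s sE] : perm_eq (sort >=%R t) t by rewrite perm_sort.
exists s => i j ij /=.
have tE k : d (s k) = nth 0 (sort >=%R t) k.
  by rewrite sE -tnth_nth /= !tnth_mktuple.
have srt : sorted >=%R (sort >=%R t) by apply: sort_sorted => x y; apply: le_total.
rewrite !tE; apply: (sorted_leq_nth _ _ 0 srt) => //.
- by move=> x y z yx xz; apply: le_trans xz yx.
- by move=> x; apply: lexx.
- by rewrite inE size_sort size_tuple.
- by rewrite inE size_sort size_tuple.
Qed.

Lemma hermitian_rcdiag n (A : 'M[C]_n) : A ^t* = A ->
  exists (U : 'M[C]_n) d, [/\ U \is unitarymx, decreasing_fun d & A = rcdiag U d].
Proof.
move=> /hermitian_cdiag [U [d [uU dr AE]]].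
have [s sd] := decreasing_perm (fun i => complex.Re (d i)).
exists (perm_mx s *m U), ((fun i => complex.Re (d i)) \o s); split; [|exact: sd|].
  apply: mul_unitarymx uU; apply/unitarymxP.
  by rewrite tr_perm_mx map_perm_mx -perm_mxM mulgV perm_mx1.
rewrite /rcdiag cdiag_mul AE {1}cdiagE; do 2!congr (_ *m _).
rewrite cdiagE mul_mx_diag; apply/matrixP => i j; rewrite !mxE.
rewrite (bigD1 ((s^-1)%g j)) //= big1 => [|k kj]; last first.
  rewrite !mxE; case: (altP (s k =P j)) => [e|]; last by rewrite mulr0.
  by rewrite -e permK eqxx in kj.
rewrite !mxE permKV !eqxx mulr1 addr0 RRe_real // eq_sym.
by case: eqP => [->|]; rewrite ?conjC1 ?conjC0 ?mul1r ?mul0r.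
Qed.

Lemma tr_rcdiag_Re m n (J : 'M[C]_(m, n)) d (E : 'M[C]_n) : psd E ->
  \tr (E *m rcdiag J d) = (\sum_i d i * complex.Re ((J *m E *m J ^t*) i i))%:C.
Proof.
move=> pE; rewrite mxtrace_mulC cdiag_tr rmorph_sum; apply: eq_bigr => i _.
rewrite rmorphM /= RRe_real // ger0_real //; apply: psd_entry_ge0.
exact: psd_congr.
Qed.

(** The upper bound in Ky Fan's maximum principle: the diagonal of [U G U^*] has entries in [0, 1]
    and sum at most [m]. *)
Lemma tr_le_top_sum n m (G U : 'M[C]_n) y : contraction_rank m G -> U \is unitarymx ->
  decreasing_fun y -> (forall i, 0 <= y i) -> \tr (G *m rcdiag U y) <= (top_sum m y)%:C.
Proof.
move=> [_ pG p1G tG _] uU yd y0; rewrite tr_rcdiag_Re // lecR.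
under eq_bigr do rewrite mulrC.
pose w i := (U *m G *m U ^t*) i i.
have w0 i : 0 <= w i by apply/psd_entry_ge0/psd_congr.
have w1 i : w i <= 1.
  have := psd_entry_ge0 i (psd_congr U p1G).
  rewrite mulmxBr mulmxBl mulmx1 (unitarymxP _) //.
  by rewrite -[w i]/((U *m G *m U ^t*) i i) !mxE eqxx subr_ge0.
have wr i : (complex.Re (w i))%:C = w i by rewrite RRe_real // ger0_real.
apply: weighted_sum_le_top => //.
  by move=> i; rewrite -!lecR wr w0 w1.
rewrite -lecR rmorph_sum /= rmorph_nat; under eq_bigr do rewrite wr.
apply: le_trans tG; rewrite le_eqVlt; apply/orP; left; apply/eqP.
by rewrite -[LHS]/(\tr _) mxtrace_mulC mulmxA unitarymxE // mul1mx.
Qed.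

Definition top_proj n m (U : 'M[C]_n) : 'M[C]_n := cdiag U (fun i => (i < m)%N%:R).

Lemma card_ord_ltn n m : (#|[pred i : 'I_n | (i < m)%N]| <= m)%N.
Proof.
have [nm|/ltnW mn] := leqP n m.
  by apply: leq_trans nm; rewrite -[leqRHS]card_ord max_card.
by rewrite -sum1_card -(big_ord_widen n (fun=> 1%N) mn) sum_nat_const card_ord muln1.
Qed.

Lemma top_proj_contraction n m (U : 'M[C]_n) : U \is unitarymx ->
  contraction_rank m (top_proj m U).
Proof.
move=> uU; apply: (contraction_rank_proj (S := [pred i : 'I_n | (i < m)%N])) => //.
exact: card_ord_ltn.
Qed.

Lemma tr_proj_rcdiag n (U : 'M[C]_n) (S : pred 'I_n) s : U \is unitarymx ->
  \tr (cdiag U (fun i => (S i)%:R) *m rcdiag U s) = (\sum_(i | S i) s i)%:C.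
Proof.
move=> uU; rewrite cdiag_tr /rcdiag cdiag_id // rmorph_sum /= [RHS]big_mkcond /=.
apply: eq_bigr => i _; rewrite !mxE eqxx mulr1n.
by case: (S i); rewrite ?mul1r ?mul0r.
Qed.

(** Pairs inside [S] balance by symmetry of [rho]. For [i] in [S] and [j] outside, [t j <= t i]
    makes the right term larger, and where [t j = 0], with inverse 0 by default, [rho] vanishes. *)
Lemma chebyshev_sum n m (t : 'I_n -> R) (rho : 'I_n -> 'I_n -> R)
    (S := [pred i : 'I_n | (i < m)%N && (0 < t i)]) :
  decreasing_fun t -> (forall i, 0 <= t i) -> (forall i j, 0 <= rho i j) ->
  (forall i j, rho i j = rho j i) -> (forall i j, t j = 0 -> rho i j = 0) ->
  \sum_(i | S i) \sum_j rho i j / t i <= \sum_(i | S i) \sum_j rho i j / t j.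
Proof.
move=> td t0 rho0 rhoC rhot.
under eq_bigr do rewrite (bigID S) /=.
under [leRHS]eq_bigr do rewrite (bigID S) /=.
rewrite !big_split /=; apply: lerD.
  rewrite exchange_big /= le_eqVlt; apply/orP; left; apply/eqP.
  by apply: eq_bigr => i _; apply: eq_bigr => j _; rewrite rhoC.
apply: ler_sum => i /andP[im ti]; apply: ler_sum => j Sj.
have [/rhot ->|tj] := eqVneq (t j) 0; first by rewrite !mul0r.
have {}tj : 0 < t j by rewrite lt_def tj t0.
move: Sj; rewrite tj andbT -leqNgt => mj.
rewrite ler_wpM2l // lef_pV2 ?posrE //; apply: td.
exact: leq_trans (ltnW im) mj.
Qed.

(** The hypotheses give [P - Y = (P - Y)^2 + (Y - Y^2)]. *)
Lemma psd_sub_proj n (P Y : 'M[C]_n) : P ^t* = P -> Y ^t* = Y -> P *m P = P ->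
  P *m Y = Y -> Y *m P = Y -> psd (Y - Y *m Y) -> psd (P - Y).
Proof.
move=> hP hY PP PY YP pY.
have -> : P - Y = (P - Y) *m (P - Y) + (Y - Y *m Y).
  rewrite mulmxBl !mulmxBr PP PY YP.
  by rewrite subrK.
apply: psdD; last exact: pY.
by apply: hermitian_square_psd; rewrite adjmxB hP hY.
Qed.

End KyFan.

(** * Sums of positive matrices *)

Section Angle.
Variables (R : realType) (N : nat).
Local Notation C := R[i].

Definition angle (c t : R) : R := Num.max (t - c) 0.

Lemma angle_ge0 c t : 0 <= angle c t.
Proof. by rewrite le_max lexx orbT. Qed.

(* [Y = P^1/2 T^+ P^1/2], where the Moore-Penrose inverse [T^+] of
   [T = V^* diag(t) V] is [V^* diag(1/t) V] because [0^-1 = 0]. *)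
Definition half_conj p (J : 'M[C]_(p, N)) a (V : 'M[C]_N) t : 'M[C]_N :=
  rcdiag J (fun i => Num.sqrt (a i)) *m rcdiag V (fun i => (t i)^-1)
  *m rcdiag J (fun i => Num.sqrt (a i)).

Section HalfConj.
Variables (p : nat) (J : 'M[C]_(p, N)) (a : 'I_p -> R) (V : 'M[C]_N) (t : 'I_N -> R).
Hypotheses (uJ : J \is unitarymx) (uV : V \is unitarymx).
Hypotheses (a0 : forall i, 0 <= a i) (t0 : forall i, 0 <= t i).
Hypotheses (td : decreasing_fun t) (PT : psd (rcdiag V t - rcdiag J a)).

Let H := rcdiag J (fun i => Num.sqrt (a i)).

Lemma half_sqr : H *m H = rcdiag J a.
Proof.
rewrite (rcdiagM _ _ uJ); apply: eq_rcdiag => i; rewrite -expr2.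
exact: sqr_sqrtr (a0 i).
Qed.

Lemma half_conj_adj : (half_conj J a V t) ^t* = half_conj J a V t.
Proof. exact: adjmx_hermitian_sandwich (rcdiag_adj _ _) (rcdiag_adj _ _). Qed.

(** With [D = T^+], [D T D = D] and [H H = P] turn [Y - Y^2] into [H D (T - P) D H], which is
    positive; the support projection absorbs [H]. *)
Lemma psd_support_sub_half_conj :
  psd (rcdiag J (fun i => (0 < a i)%R%:R) - half_conj J a V t).
Proof.
set S := rcdiag J (fun i => _).
have sS : (S *m H = H) * (H *m S = H).
  by split; rewrite (rcdiagM _ _ uJ); apply: eq_rcdiag => i; have := a0 i;
    rewrite le_eqVlt => /orP[/eqP <-|->]; rewrite ?ltxx ?sqrtr0 ?mulr0 ?mul0r ?mulr1 ?mul1r.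
apply: psd_sub_proj.
- exact: rcdiag_adj.
- exact: half_conj_adj.
- by rewrite (rcdiagM _ _ uJ); apply: eq_rcdiag => i; case: (0 < a i); rewrite ?mulr1 ?mulr0.
- by rewrite /half_conj !mulmxA sS.1.
- by rewrite /half_conj -mulmxA sS.2.
set D := rcdiag V (fun i => (t i)^-1).
have DTD : D *m rcdiag V t *m D = D.
  rewrite !(rcdiagM _ _ uV); apply: eq_rcdiag => i; have [->|ti] := eqVneq (t i) 0.
    by rewrite invr0 mulr0.
  by rewrite mulVf // mul1r.
have -> : half_conj J a V t - half_conj J a V t *m half_conj J a V t =
    (H *m D) *m (rcdiag V t - rcdiag J a) *m (H *m D) ^t*.
  rewrite /half_conj -/H -/D (adjmx_hermitianM (rcdiag_adj _ _) (rcdiag_adj _ _)).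
  rewrite -/H -/D mulmxBr mulmxBl -half_sqr.
  by rewrite -{1}DTD !mulmxA.
exact: psd_congr PT.
Qed.

(** With [rho i j] the squared moduli of the entries of [P^1/2] in the eigenbasis of [T], the left
    side sums [rho i j / t i] and the right side [rho i j / t j]. *)
Lemma tr_half_conj_ge m (S := [pred i : 'I_N | (i < m)%N && (0 < t i)]) :
  \sum_(i | S i) (V *m rcdiag J a *m V ^t*) i i / (t i)%:C <=
  \tr (cdiag V (fun i => (S i)%:R) *m half_conj J a V t).
Proof.
pose r := V *m H *m V ^t*.
have hr : r ^t* = r by rewrite /r adjmx_hermitian_congr ?rcdiag_adj.
have rC i j : r i j = ((r j i)^*)%R by rewrite -{1}hr !mxE.
pose rho i j := complex.Re (r i j * r j i).
have rhoE i j : (rho i j)%:C = r i j * r j i.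
  by rewrite RRe_real // [r j i]rC ger0_real // mul_conjC_ge0.
have rho0 i j : 0 <= rho i j by rewrite -ler0c rhoE [r j i]rC mul_conjC_ge0.
have rr : r *m r = V *m rcdiag J a *m V ^t*.
  rewrite -half_sqr /r !mulmxA; congr (_ *m _).
  by rewrite -[_ *m V ^t* *m V]mulmxA (unitarymxE uV) mulmx1.
have diagE i : (V *m rcdiag J a *m V ^t*) i i = (\sum_j rho i j)%:C.
  by rewrite -rr mxE rmorph_sum; apply: eq_bigr => j _; rewrite /= rhoE.
have rhoC i j : rho i j = rho j i by rewrite /rho mulrC.
have rhot i j : t j = 0 -> rho i j = 0.
  (* [P <= T] forces the diagonal entry of [P] at [j], which is a sum of the [rho j i], to
     vanish. *)
  move=> tj; apply/eqP; rewrite eq_le rho0 andbT.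
  have := psd_entry_ge0 j (psd_congr V PT).
  rewrite mulmxBr mulmxBl (cdiag_id _ uV) mxE [X in _ + X]mxE diagE !mxE eqxx mulr1n.
  rewrite -rmorphB ler0c tj sub0r oppr_ge0; apply: le_trans.
  by rewrite rhoC (bigD1 i) //= lerDl sumr_ge0.
have -> : \tr (cdiag V (fun i => (S i)%:R) *m half_conj J a V t) =
    (\sum_(i | S i) \sum_j rho i j / t j)%:C.
  rewrite cdiag_tr rmorph_sum /= [RHS]big_mkcond /=; apply: eq_bigr => i _.
  case: ifP => _; last by rewrite mul0r.
  rewrite mul1r (_ : V *m _ *m _ = r *m diag_mx (\row_i ((t i)^-1)%:C) *m r); last first.
    by rewrite /half_conj -/H /r /rcdiag cdiagE !mulmxA.
  rewrite mul_mx_diag mxE rmorph_sum; apply: eq_bigr => j _.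
  by rewrite [X in X * _]mxE [X in _ * X * _]mxE rmorphM /= rhoE mulrAC.
have -> : \sum_(i | S i) (V *m rcdiag J a *m V ^t*) i i / (t i)%:C =
    (\sum_(i | S i) \sum_j rho i j / t i)%:C.
  rewrite rmorph_sum; apply: eq_bigr => i _.
  by rewrite diagE -mulr_suml /= rmorphM fmorphV.
by rewrite lecR; apply: chebyshev_sum.
Qed.

End HalfConj.

Lemma psd_sub_angle p (J : 'M[C]_(p, N)) a c : (forall i, 0 <= a i) -> 0 <= c ->
  psd (rcdiag J a - rcdiag J (fun i => angle c (a i))
       - c%:C *: rcdiag J (fun i => (0 < angle c (a i))%R%:R)).
Proof.
move=> a0 c0; rewrite rcdiagZ !rcdiagB; apply: psd_rcdiag => i.
rewrite /angle maxEge; case: ifP; rewrite ?ltxx => h.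
  by rewrite opprB addrC addrA; case: ltP => h'; rewrite ?mulr1 ?mulr0; have := a0 i; lra.
by rewrite mulr0 !subr0.
Qed.

End Angle.

Lemma sub_regroup (V : zmodType) (a p x y b q z w : V) :
  (a - p - x + (x - y)) + (b - q - z + (z - w)) = a + b - (p + q + (y + w)).
Proof. by rewrite !subrKA addrACA [X in X + _ = _]addrACA !opprD [RHS]addrA. Qed.

(** * The positive case *)

Section PositiveSum.
Variables (R : realType) (N p q : nat).
Local Notation C := R[i].
Variables (J : 'M[C]_(p, N)) (K : 'M[C]_(q, N)) (W : 'M[C]_N).
Variables (a : 'I_p -> R) (b : 'I_q -> R) (s : 'I_N -> R).
Hypotheses (uJ : J \is unitarymx) (uK : K \is unitarymx) (uW : W \is unitarymx).
Hypotheses (a0 : forall i, 0 <= a i) (b0 : forall i, 0 <= b i).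
Hypotheses (sd : decreasing_fun s) (sE : rcdiag J a + rcdiag K b = rcdiag W s).

Lemma psd_sum_spectrum_ge0 i : 0 <= s i.
Proof.
apply: (psd_rcdiag_ge0 uW); rewrite -sE.
exact: psdD (psd_rcdiag _ a0) (psd_rcdiag _ b0).
Qed.

Lemma tr_angle_le m c (G : 'M[C]_N) : 0 <= c -> contraction_rank m G ->
  \tr (G *m (rcdiag J (fun i => angle c (a i)) + rcdiag K (fun i => angle c (b i))))
  <= (top_sum m (fun i => angle c (s i)))%:C.
Proof.
move=> c0 cG.
set P := rcdiag J _; set Q := rcdiag K _.
have pP : psd P by apply: psd_rcdiag => i; apply: angle_ge0.
have pQ : psd Q by apply: psd_rcdiag => i; apply: angle_ge0.
have hPQ : (P + Q) ^t* = P + Q by rewrite adjmxD !rcdiag_adj.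
have [V [t [uV td TE]]] := hermitian_rcdiag hPQ.
have t0 : forall i, 0 <= t i.
  by apply: (psd_rcdiag_ge0 uV); rewrite -TE; apply: psdD.
rewrite TE; apply: le_trans (tr_le_top_sum cG uV td t0) _; rewrite lecR.
(* Discarding zero eigenvalues of [T] keeps its top sum and lets every remaining index be divided by
   [t i]. *)
pose S := [pred i : 'I_N | (i < m)%N && (0 < t i)].
have Sm : (#|S| <= m)%N.
  apply: leq_trans (card_ord_ltn N m); apply: subset_leq_card.
  by apply/subsetP => i; rewrite !inE => /andP[].
have SN : (#|S| <= N)%N by rewrite -[leqRHS]card_ord max_card.
pose E := cdiag V (fun i => (S i)%:R).
have cE : contraction_rank #|S| E by apply: contraction_rank_proj uV (leqnn _).
pose YP := half_conj J (fun i => angle c (a i)) V t.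
pose YQ := half_conj K (fun i => angle c (b i)) V t.
have TP : psd (rcdiag V t - P) by rewrite -TE addrC addKr.
have TQ : psd (rcdiag V t - Q) by rewrite -TE addrK.
have psdS : psd (rcdiag W s - (rcdiag V t + c%:C *: (YP + YQ))).
  have pYP := psd_support_sub_half_conj uJ uV (fun i => angle_ge0 c (a i)) TP.
  have pYQ := psd_support_sub_half_conj uK uV (fun i => angle_ge0 c (b i)) TQ.
  have pA := psd_sub_angle J a0 c0; have pB := psd_sub_angle K b0 c0.
  have cC : 0 <= c%:C by rewrite ler0c.
  (* The support projections of [P] and [Q] cancel in this sum. *)
  have := psdD (psdD pA (psdZ cC pYP)) (psdD pB (psdZ cC pYQ)).
  by rewrite !scalerBr sub_regroup -scalerDr sE TE.
have trS : (top_sum m t + c * #|S|%:R)%:C <= \tr (E *m rcdiag W s).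
  have := psd_tr_cdiag_ge0 V (fun i => ler0n C (S i)) psdS.
  rewrite -/E mulmxBr raddfB /= subr_ge0 => /(le_trans _); apply.
  rewrite mulmxDr mxtraceD /= rmorphD; apply: lerD.
    rewrite (tr_proj_rcdiag _ _ uV) lecR /top_sum (bigID S) /= [X in _ + X]big1 ?addr0.
      rewrite le_eqVlt; apply/orP; left; apply/eqP; apply: eq_bigl => i.
      by rewrite andbA andbb.
    by move=> i /andP[-> /=]; rewrite -leNgt => ti; apply/eqP; rewrite eq_le ti t0.
  rewrite -scalemxAr mxtraceZ rmorphM /= ler_wpM2l ?ler0c // mulmxDr mxtraceD /=.
  have hP := tr_half_conj_ge uJ uV (fun i => angle_ge0 c (a i)) t0 td TP m.
  have hQ := tr_half_conj_ge uK uV (fun i => angle_ge0 c (b i)) t0 td TQ m.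
  apply: le_trans (lerD hP hQ); rewrite -big_split /= -/P -/Q.
  (* The diagonal of [V (P + Q) V^*] is [t], so each [i] in [S] contributes exactly 1. *)
  rewrite rmorph_nat -sum1_card natr_sum; apply: ler_sum => i /andP[_ ti].
  have := congr1 (fun M => (V *m M *m V ^t*) i i) TE.
  rewrite /= mulmxDr mulmxDl mxE (cdiag_id _ uV) [RHS]mxE eqxx mulr1n => e.
  rewrite -mulrDl e mxE.
  by rewrite mulfV // -[0]/((0 : R)%:C) (inj_eq (@complexI R)) gt_eqF.
have := le_trans trS (tr_le_top_sum cE uW sd psd_sum_spectrum_ge0); rewrite lecR.
rewrite -lerBrDr => h; apply: le_trans h _.
(* Charging [c] to each of the top eigenvalues of the sum leaves at most their angles; further
   angles up to [m] are nonnegative. *)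
have -> : c * #|S|%:R = top_sum #|S| (fun _ : 'I_N => c).
  rewrite /top_sum -(big_ord_widen N (fun=> c) SN) sumr_const card_ord.
  by rewrite mulr_natr.
rewrite /top_sum -sumrB.
apply: (@le_trans _ _ (top_sum #|S| (fun i => angle c (s i)))).
  by apply: ler_sum => i _; rewrite /angle le_max lexx.
rewrite /top_sum [leLHS]big_mkcond [leRHS]big_mkcond; apply: ler_sum => i _ /=.
case: ltnP => iS; first by rewrite (leq_trans iS Sm).
by case: ifP => // _; apply: angle_ge0.
Qed.

Lemma tr_concave_ge m f : concave_nneg f -> f 0 = 0 ->
  (top_sum m (fun i => f (s i)))%:C <=
  \tr (top_proj m W *m (rcdiag J (fun i => f (a i)) + rcdiag K (fun i => f (b i)))).
Proof.
move=> fc f0; set E := top_proj m W.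
have cE : contraction_rank m E by apply: top_proj_contraction.
have pE : psd E by case: cE.
(* One signed weight on all three spectra: diagonal entries of [E] for the summands, minus the
   indicator of the top [m] for the sum. The trace gap becomes linear in the function, so
   [concave_sum_ge0] applies. *)
pose I := ('I_p + 'I_q + 'I_N)%type.
pose w (k : I) : R := match k with
  | inl (inl i) => complex.Re ((J *m E *m J ^t*) i i)
  | inl (inr i) => complex.Re ((K *m E *m K ^t*) i i)
  | inr i => - (i < m)%N%:R end.
pose t (k : I) : R := match k with inl (inl i) => a i | inl (inr i) => b i | inr i => s i end.
have trE g : \tr (E *m (rcdiag J (fun i => g (a i)) + rcdiag K (fun i => g (b i)))) =
    (\sum_k w k * g (t k) + top_sum m (fun i => g (s i)))%:C.
  rewrite mulmxDr mxtraceD /= !tr_rcdiag_Re // -rmorphD /=; congr (_%:C).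
  rewrite !big_sumType /= -!addrA; congr (_ + _); first by apply: eq_bigr => i _; rewrite mulrC.
  rewrite -[LHS]addr0; congr (_ + _); first by apply: eq_bigr => i _; rewrite mulrC.
  rewrite /top_sum [X in _ + X]big_mkcond -big_split /= big1 // => i _.
  by case: ifP; rewrite ?mulNr ?mul1r ?mul0r ?subrr ?oppr0 ?addr0 // addNr.
rewrite trE lecR lerDr; apply: concave_sum_ge0 => //.
- by case=> [[]|] i; [exact: a0|exact: b0|exact: psd_sum_spectrum_ge0].
- have := trE id; rewrite sE (tr_proj_rcdiag _ _ uW) => /complexI.
  by rewrite -[X in X = _]add0r => /addIr.
- move=> c c0; have := tr_angle_le c0 cE.
  by rewrite (trE (angle c)) lecR gerDr.
Qed.

End PositiveSum.

(** * Functional calculus, symmetric norms, Weyl inequality *)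

Section FunctionalCalculus.
Variables (R : realType) (n : nat).
Local Notation C := R[i].

(** [W = U V^*] intertwines the two diagonals, so [d i = e j] wherever [W i j] is nonzero, and [W]
    intertwines their images under [f]. *)
Lemma rcdiag_fun_unique (U V : 'M[C]_n) d e (f : R -> R) : U \is unitarymx ->
  V \is unitarymx -> rcdiag U d = rcdiag V e ->
  rcdiag U (fun i => f (d i)) = rcdiag V (fun i => f (e i)).
Proof.
move=> uU uV UV; pose W := U *m V ^t*.
have WE g k : (diag_mx (\row_i (g (d i))%:C) *m W = W *m diag_mx (\row_i (k (e i))%:C)) <->
    (forall i j, (g (d i))%:C * W i j = W i j * (k (e j))%:C).
  rewrite mul_diag_mx mul_mx_diag; split.
    by move=> /matrixP h i j; have := h i j; rewrite !mxE.
  by move=> h; apply/matrixP => i j; have := h i j; rewrite !mxE.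
have : diag_mx (\row_i (id (d i))%:C) *m W = W *m diag_mx (\row_i (id (e i))%:C).
  have := congr1 (fun M => U *m M *m V ^t*) UV; rewrite /= /rcdiag !cdiagE /W.
  rewrite !mulmxA (unitarymxP uU) mul1mx => ->.
  by rewrite -[_ *m V *m V ^t*]mulmxA (unitarymxP uV) mulmx1.
move=> /(WE id id) h; have /(WE f f) fW : forall i j, (f (d i))%:C * W i j = W i j * (f (e j))%:C.
  move=> i j; have [->|w0] := eqVneq (W i j) 0; first by rewrite mulr0 mul0r.
  by have := h i j; rewrite mulrC => /(mulfI w0) /complexI ->; rewrite mulrC.
have UE : U = W *m V by rewrite /W -mulmxA (unitarymxE uV) mulmx1.
rewrite /rcdiag !cdiagE {2}UE mulmxA -[_ *m _ *m W]mulmxA fW /W.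
by congr (_ *m V); rewrite -(mulmxA U) mulmxA (unitarymxE uU) mul1mx.
Qed.

Lemma mfun_rcdiag (U : 'M[C]_n) d (f : R -> R) : U \is unitarymx ->
  mfun f (rcdiag U d) = rcdiag U (fun i => f (d i)).
Proof.
move=> uU; rewrite /mfun; case: pselect => [h|[]].
  have [] := projT2 (cid h); case: (projT1 (cid h)) => V e /= uV VE.
  have mapE (g : R -> R) : map_mx (fun x => (g x)%:C) e = \row_i (g (e 0 i))%:C.
    by apply/rowP => i; rewrite !mxE.
  rewrite mapE -cdiagE; apply/esym/(rcdiag_fun_unique (e := fun i => e 0 i) _ uU uV).
  by rewrite VE (mapE id) -cdiagE.
exists (U, \row_i d i); split; first exact: uU.
rewrite /rcdiag cdiagE; do 2!congr (_ *m _).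
by congr diag_mx; apply/rowP => i; rewrite !mxE.
Qed.

End FunctionalCalculus.

Section SymmetricNorm.
Variables (R : realType) (n : nat) (N : 'M[R[i]]_n -> R).
Hypothesis symN : symmetric_norm N.

(** The symmetric gauge function of [N]. *)
Definition dnorm (y : 'I_n -> R) : R := N (rcdiag 1%:M y).

Lemma unitarymx1 : (1%:M : 'M[R[i]]_n) \is unitarymx.
Proof. by apply/unitarymxP; rewrite adjmx1 mulmx1. Qed.

Lemma norm_rcdiag (U : 'M_n) y : U \is unitarymx -> N (rcdiag U y) = dnorm y.
Proof.
case: symN => _ _ _ _ NU uU; rewrite /dnorm -[in LHS](mul1mx U) /rcdiag cdiag_mul.
by apply: NU; rewrite ?trmxC_unitary.
Qed.

(** Used with [z] the image of [y] under a transposition or a sign change. *)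
Lemma dnorm_convex th (x y z : 'I_n -> R) : 0 <= th <= 1 ->
  (forall i, x i = th * y i + (1 - th) * z i) -> dnorm z = dnorm y -> dnorm x <= dnorm y.
Proof.
case: symN => _ _ NZ ND _ /andP[th0 th1] xE zy.
have NZr a X : 0 <= a -> N (a%:C *: X) = a * N X.
  by move=> a0; apply: (@complexI R); rewrite NZ ger0_norm ?ler0c // rmorphM.
have -> : dnorm x = N (th%:C *: rcdiag 1%:M y + (1 - th)%:C *: rcdiag 1%:M z).
  by rewrite !rcdiagZ rcdiagD; congr N; apply: eq_rcdiag.
apply: (le_trans (ND _ _)); rewrite !NZr ?subr_ge0 //.
by rewrite -!/(dnorm _) zy; lra.
Qed.

Lemma dnorm_tperm y j k : dnorm (y \o tperm j k) = dnorm y.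
Proof.
pose s := tperm j k.
have us : (perm_mx s : 'M[R[i]]_n) \is unitarymx.
  by apply/unitarymxP; rewrite tr_perm_mx map_perm_mx -perm_mxM mulgV perm_mx1.
rewrite -(norm_rcdiag _ us) /dnorm; congr N.
rewrite /rcdiag !cdiagE adjmx1 mul1mx mulmx1 !mul_mx_diag.
apply/matrixP => a b; rewrite !mxE.
rewrite (bigD1 (s b)) //= big1 => [|i ib]; last first.
  rewrite !mxE; case: (altP (s i =P b)) => [e|]; last by rewrite mulr0.
  by rewrite -e tpermK eqxx in ib.
rewrite !mxE tpermK !eqxx mulr1 addr0 eq_sym.
by case: eqP => [->|]; rewrite ?conjC1 ?conjC0 ?mul1r ?mul0r.
Qed.

Lemma dnorm_sign y i : dnorm (fun k => if k == i then - y k else y k) = dnorm y.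
Proof.
case: symN => _ _ _ _ NU.
pose e (k : 'I_n) : R := if k == i then -1 else 1.
have ue : rcdiag 1%:M e \is unitarymx.
  apply/unitarymxP; rewrite rcdiag_adj (rcdiagM _ _ unitarymx1).
  rewrite -[RHS](cdiag_const _ unitarymx1); apply: eq_cdiag => k.
  by rewrite /e; case: ifP; rewrite ?mulrNN mulr1.
rewrite -[RHS](NU _ _ _ ue unitarymx1) mulmx1 (rcdiagM _ _ unitarymx1); congr N.
by apply: eq_rcdiag => k; rewrite /e; case: ifP; rewrite ?mulN1r ?mul1r.
Qed.

(** A Robin Hood transfer averages [y] with a transposed copy, and shrinking a coordinate averages
    [y] with a copy where its sign is flipped. *)
Lemma dnorm_weakly_majorized x y : decreasing_fun x -> (forall i, 0 <= x i) ->
  weakly_majorized x y -> dnorm x <= dnorm y.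
Proof.
apply: gauge_weakly_majorized => {x y} [y j k a b njk /andP[ya ay] ab|y i a /andP[a0 ay]].
  have [e|e] := eqVneq (y j) (y k).
    rewrite le_eqVlt; apply/orP; left; apply/eqP; congr N; apply: eq_rcdiag => i.
    by rewrite /upd; case: eqP => [->|_]; [lra|case: eqP => [->|//]; lra].
  have d0 : 0 < y j - y k by rewrite subr_gt0 lt_def e (le_trans ya ay).
  pose th := (y j - a) / (y j - y k).
  have thE : th * (y j - y k) = y j - a by rewrite /th divfK // gt_eqF.
  apply: (dnorm_convex (th := th) _ _ (dnorm_tperm y j k)).
    by rewrite divr_ge0 ?(ltW d0) ?subr_ge0 //= ler_pdivrMr //; lra.
  move=> i; rewrite /upd /=; case: (eqVneq i k) => [->|ik]; first by rewrite tpermR; lra.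
  case: (eqVneq i j) => [->|ij]; first by rewrite tpermL; lra.
  by rewrite tpermD 1?eq_sym //; lra.
have [y0|y0] := eqVneq (y i) 0.
  have {}a0 : a = 0 by apply: le_anti; rewrite a0 -y0 ay.
  rewrite le_eqVlt; apply/orP; left; apply/eqP; congr N; apply: eq_rcdiag => k.
  by rewrite /upd; case: eqP => [->|//]; rewrite y0 a0.
have yi : 0 < y i by rewrite lt_def y0 (le_trans a0 ay).
(* Solves [th * y i - (1 - th) * y i = a]. *)
pose th := (a / y i + 1) / 2.
have ayE : a / y i * y i = a by rewrite divfK.
have ay0 : 0 <= a / y i by rewrite divr_ge0 // ltW.
have ay1 : a / y i <= 1 by rewrite ler_pdivrMr // mul1r.
apply: (dnorm_convex (th := th) _ _ (dnorm_sign y i)); first by rewrite /th; lra.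
by move=> k; rewrite /upd; case: (eqVneq k i) => [->|_]; rewrite /th; lra.
Qed.

End SymmetricNorm.

Section Weyl.
Variables (R : realType) (n n' : nat).
Local Notation C := R[i].

(** A Courant-Fischer dimension count: some nonzero [c] supported on indices up to [i] makes [c Z]
    orthogonal to the first [i] eigenvectors, where the form is at most [s i]. *)
Lemma weyl_le (W : 'M[C]_(n + n')) s (Z : 'M[C]_(n, n + n')) (i : 'I_n) x :
  W \is unitarymx -> decreasing_fun s ->
  (forall c : 'rV[C]_n, (forall j : 'I_n, (i < j)%N -> c 0 j = 0) ->
     let v := c *m Z in
     (v *m v ^t*) 0 0 = (c *m c ^t*) 0 0 /\
     x%:C * (c *m c ^t*) 0 0 <= (v *m rcdiag W s *m v ^t*) 0 0) ->
  x <= s (lshift n' i).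
Proof.
move=> uW sd hZ; pose M := Z *m W ^t*.
(* Columns before [i] encode the orthogonality, columns after [i] the vanishing of [c]; the zero
   column [i] makes [Q] singular. *)
pose Q : 'M[C]_n := \matrix_(a, b) if (b < i)%N then M a (lshift n' b)
  else if (i < b)%N then (a == b)%:R else 0.
have /det0P [c c0 cQ] : \det Q == 0.
  rewrite (expand_det_col _ i) big1 // => a _.
  by rewrite mxE !ltnn mul0r.
have cj (j : 'I_n) : (i < j)%N -> c 0 j = 0.
  move=> ij; have /rowP /(_ j) := cQ; rewrite !mxE (bigD1 j) //= big1 => [|k kj].
    by rewrite mxE ltnNge (ltnW ij) /= ij eqxx mulr1 addr0.
  by rewrite mxE ltnNge (ltnW ij) /= ij (negPf kj) mulr0.
pose y := c *m M.
have yj (j : 'I_(n + n')) : (j < i)%N -> y 0 j = 0.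
  move=> ji; have jn := ltn_trans ji (ltn_ord i).
  have -> : j = lshift n' (Ordinal jn) by apply: val_inj.
  have /rowP /(_ (Ordinal jn)) := cQ; rewrite !mxE => {2}<-.
  by apply: eq_bigr => k _; rewrite [Q _ _]mxE /= ji.
have [vv Sv] := hZ c cj; set v := c *m Z in vv Sv.
have yE : y = v *m W ^t* by rewrite /y /M mulmxA.
have yy : (y *m y ^t*) 0 0 = (c *m c ^t*) 0 0.
  by rewrite yE (adjmxM v) trmxCK mulmxA mulmxKtV // vv.
have cc : 0 < (c *m c ^t*) 0 0.
  have [j cj0] : exists j, c 0 j != 0.
    apply/existsP; apply: contraT => /existsPn h; case/eqP: c0.
    by apply/rowP => j; rewrite mxE; apply/eqP; rewrite -[_ == _]negbK h.
  rewrite mxE (bigD1 j) //= ltr_wpDr //.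
    by apply: sumr_ge0 => k _; rewrite !mxE mul_conjC_ge0.
  by rewrite !mxE mul_conjC_gt0.
rewrite -lecR -(ler_pM2r cc); apply: (le_trans Sv).
have -> : v *m rcdiag W s *m v ^t* = y *m diag_mx (\row_j (s j)%:C) *m y ^t*.
  by rewrite /rcdiag cdiagE yE (adjmxM v) trmxCK !mulmxA.
clearbody y.
rewrite -yy mul_mx_diag !mxE mulr_sumr; apply: ler_sum => j _.
rewrite !mxE mulrAC [leLHS]mulrC.
have [ji|ij] := ltnP j i; first by rewrite yj // mul0r !mulr0.
by apply: ler_wpM2r; rewrite ?mul_conjC_ge0 // lecR; apply: sd.
Qed.

End Weyl.

Section SingularValues.
Variables (R : realType) (n : nat).
Local Notation C := R[i].

Lemma row_diag_form (u w : 'rV[C]_n) (d : 'I_n -> C) :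
  (u *m diag_mx (\row_j d j) *m w ^t*) 0 0 = \sum_j u 0 j * d j * ((w 0 j)^*)%R.
Proof. by rewrite mul_mx_diag mxE; apply: eq_bigr => j _; rewrite !mxE. Qed.

Lemma singular_value_le (X Wx : 'M[C]_n) x (W : 'M[C]_(n + n)) s (i : 'I_n) :
  Wx \is unitarymx -> decreasing_fun x -> (forall i, 0 <= x i) ->
  X ^t* *m X = rcdiag Wx (fun i => x i * x i) ->
  W \is unitarymx -> decreasing_fun s -> (forall i, 0 <= s i) ->
  psd (rcdiag W s - block_mx 0 X (X ^t*) 0) -> x i <= s (lshift n i).
Proof.
move=> uWx xd x0 XX uW sd s0 SX.
(* Once [x i > 0], all [x j] with [j <= i] are invertible. *)
have [->|xi] := eqVneq (x i) 0; first exact: s0.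
have {}xi : 0 < x i by rewrite lt_def xi x0.
pose h : C := sqrtC 2^-1.
have hh : h * h = 2^-1 by rewrite -expr2 sqrtCK.
have hC : (h^*)%R = h by rewrite geC0_conj // sqrtC_ge0 invr_ge0 ler0n.
have half2 (y : C) : 2^-1 * (y + y) = y.
  by rewrite -mulr2n -[y *+ 2]mulr_natl mulrA mulVf ?mul1r // pnatr_eq0.
pose D2 := diag_mx (\row_j ((x j * x j)%:C)).
have XW : Wx *m X ^t* *m X *m Wx ^t* = D2.
  by rewrite -[Wx *m _ *m _]mulmxA XX cdiag_id.
pose Di := diag_mx (\row_j ((x j)^-1%:C)).
(* The rows of [Z] met by [c] are orthonormal left eigenvectors of [[0, X], [X^*, 0]] with
   eigenvalues [x j]. *)
apply: (weyl_le (Z := h *: row_mx (Di *m Wx *m X ^t*) Wx) uW sd) => c cj v.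
pose c' : 'rV[C]_n := c *m Di.
have c'E j : c' 0 j = c 0 j * (x j)^-1%:C by rewrite /c' mul_mx_diag !mxE.
have c'x j : c' 0 j * (x j)%:C = c 0 j.
  rewrite c'E; have [ij|ji] := ltnP i j; first by rewrite cj // !mul0r.
  have xj : 0 < x j by apply: lt_le_trans xi _; apply: xd.
  by rewrite -mulrA -rmorphM mulVf ?gt_eqF // mulr1.
pose p := c' *m Wx *m X ^t*; pose q := c *m Wx.
have vE : v = h *: row_mx p q.
  by rewrite /v -scalemxAr mul_mx_row /p /q /c' !mulmxA.
have cc : (c *m c ^t*) 0 0 = \sum_j c 0 j * ((c 0 j)^*)%R.
  by rewrite mxE; apply: eq_bigr => j _; rewrite !mxE.
have vadj : v ^t* = h *: col_mx (p ^t*) (q ^t*) by rewrite vE adjmxZ adjmx_row hC.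
have qq : q *m q ^t* = c *m c ^t*.
  by rewrite /q adjmxM mulmxA -[c *m Wx *m _]mulmxA (unitarymxP uWx) mulmx1.
have padj : p ^t* = X *m Wx ^t* *m c' ^t*.
  by rewrite /p !adjmxM trmxCK mulmxA.
have pp : p *m p ^t* = c' *m D2 *m c' ^t*.
  by rewrite padj -XW /p !mulmxA.
have qp : q *m X ^t* *m p ^t* = c *m D2 *m c' ^t*.
  by rewrite padj -XW /q !mulmxA.
have pq : p *m X *m q ^t* = c' *m D2 *m c ^t*.
  by rewrite -XW /p /q adjmxM !mulmxA.
have xR j : ((x j)%:C)^*%R = (x j)%:C by apply: geC0_conj; rewrite ler0c.
have c'xC j : (x j)%:C * ((c' 0 j)^*)%R = ((c 0 j)^*)%R.
  by rewrite -c'x rmorphM /= xR mulrC.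
clearbody p q; split.
  rewrite vadj vE -scalemxAl -scalemxAr scalerA hh mul_row_col mxE [X in _ * X]mxE pp qq.
  rewrite -[RHS]half2; congr (_ * (_ + _)); rewrite row_diag_form cc.
  by apply: eq_bigr => j _; rewrite rmorphM /= mulrA c'x -mulrA c'xC.
have := psd_form_ge0 SX v; rewrite mulmxBr mulmxBl mxE [X in _ + X]mxE subr_ge0.
move=> /(le_trans _); apply.
rewrite vadj vE -scalemxAl -scalemxAl -scalemxAr scalerA hh mul_row_block !mulmx0.
rewrite add0r addr0 mul_row_col [leRHS]mxE [X in _ <= _ * X]mxE qp pq !row_diag_form.
have -> : \sum_j c 0 j * (x j * x j)%:C * ((c' 0 j)^*)%R =
          \sum_j (x j)%:C * (c 0 j * ((c 0 j)^*)%R).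
  by apply: eq_bigr => j _; rewrite rmorphM /= -!mulrA c'xC mulrCA.
have -> : \sum_j c' 0 j * (x j * x j)%:C * ((c 0 j)^*)%R =
          \sum_j (x j)%:C * (c 0 j * ((c 0 j)^*)%R).
  by apply: eq_bigr => j _; rewrite rmorphM /= [c' 0 j * _]mulrA c'x [c 0 j * _]mulrC -mulrA.
rewrite half2 cc mulr_sumr; apply: ler_sum => j _.
have [ij|ji] := ltnP i j; first by rewrite cj // mul0r !mulr0.
by apply: ler_wpM2r; rewrite ?mul_conjC_ge0 // lecR; apply: xd.
Qed.

End SingularValues.

(** * Polar form and absolute value *)

Section Normal.
Variables (R : realType) (n : nat).
Local Notation C := R[i].

Lemma normal_polar (A : 'M[C]_n) : A \is normalmx ->
  exists (U : 'M[C]_n) (ph : 'I_n -> C) (a : 'I_n -> R),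
  [/\ U \is unitarymx, forall i, ph i * ((ph i)^*)%R = 1, forall i, 0 <= a i,
      A = cdiag U (fun i => ph i * (a i)%:C) &
      A ^t* *m A = rcdiag U (fun i => a i * a i)].
Proof.
move=> /normal_cdiag [U [z [uU AE]]].
pose a i := complex.Re `|z i|.
have aE i : (a i)%:C = `|z i| by rewrite RRe_real // normr_real.
(* The value 1 at a zero eigenvalue keeps the phase unimodular. *)
pose ph i := if z i == 0 then 1 else z i / `|z i|.
have phu i : ph i * ((ph i)^*)%R = 1.
  rewrite /ph; case: eqP => [_|/eqP zi]; first by rewrite conjC1 mulr1.
  by rewrite -normCK normrM normfV normr_id divff ?expr1n // normr_eq0.
have phz i : ph i * (a i)%:C = z i.
  rewrite aE /ph; case: eqP => [->|/eqP zi]; first by rewrite normr0 mulr0.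
  by rewrite divfK // normr_eq0.
exists U, ph, a; split=> //.
- by move=> i; rewrite -ler0c aE normr_ge0.
- by rewrite AE; apply: eq_cdiag => i; rewrite phz.
- rewrite {1}AE cdiag_adj AE (cdiagM _ _ uU); apply: eq_cdiag => i.
  by rewrite mulrC -normCK expr2 -aE -rmorphM.
Qed.

Lemma absmx_rcdiag (X U : 'M[C]_n) a : U \is unitarymx -> (forall i, 0 <= a i) ->
  X ^t* *m X = rcdiag U (fun i => a i * a i) -> absmx X = rcdiag U a.
Proof.
move=> uU a0 XE; rewrite /absmx XE mfun_rcdiag //; apply: eq_rcdiag => i.
by rewrite -expr2 sqrtr_sqr ger0_norm.
Qed.

End Normal.

(** * Normal matrices *)

Lemma sub_add_sub (V : zmodType) (p p' q q' : V) :
  p + q - ((p - p') + (q - q')) = p' + q'.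
Proof. by rewrite opprD !opprB addrACA !subrKC. Qed.

Section NormalMajorization.
Variables (R : realType) (n : nat).
Local Notation C := R[i].

Lemma normal_concave_majorization (UA UB : 'M[C]_n) (pA pB : 'I_n -> C) a b
    (X Wx : 'M[C]_n) x (U : 'M[C]_n) y f :
  UA \is unitarymx -> UB \is unitarymx ->
  (forall i, pA i * ((pA i)^*)%R = 1) -> (forall i, pB i * ((pB i)^*)%R = 1) ->
  (forall i, 0 <= a i) -> (forall i, 0 <= b i) ->
  X = cdiag UA (fun i => pA i * (a i)%:C) + cdiag UB (fun i => pB i * (b i)%:C) ->
  Wx \is unitarymx -> decreasing_fun x -> (forall i, 0 <= x i) ->
  X ^t* *m X = rcdiag Wx (fun i => x i * x i) ->
  U \is unitarymx -> decreasing_fun y ->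
  rcdiag UA (fun i => f (a i)) + rcdiag UB (fun i => f (b i)) = rcdiag U y ->
  concave_nneg f -> f 0 = 0 -> (forall t, 0 <= t -> 0 <= f t) ->
  (forall t u, 0 <= t -> t <= u -> f t <= f u) ->
  weakly_majorized (fun i => f (x i)) y.
Proof.
move=> uA uB puA puB a0 b0 XE uWx xd x0 XX uU yd yE fc f0 fge0 fmono m.
have y0 : forall i, 0 <= y i.
  apply: (psd_rcdiag_ge0 uU); rewrite -yE.
  by apply: psdD; apply: psd_rcdiag => i; apply: fge0.
pose JA := dilation UA pA; pose JB := dilation UB pB.
have uJA : JA \is unitarymx := dilation_unitary uA puA.
have uJB : JB \is unitarymx := dilation_unitary uB puB.
have hS : (rcdiag JA a + rcdiag JB b) ^t* = rcdiag JA a + rcdiag JB b.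
  by rewrite adjmxD !rcdiag_adj.
have [W [s [uW sd SE]]] := hermitian_rcdiag hS.
have s0 := psd_sum_spectrum_ge0 uW a0 b0 SE.
(* The difference is the sum of the negative parts of the two dilated summands. *)
have SX : psd (rcdiag W s - block_mx 0 X (X ^t*) 0).
  have -> : block_mx 0 X (X ^t*) 0 =
      (rcdiag JA a - rcdiag (dilation UA (fun i => - pA i)) a) +
      (rcdiag JB b - rcdiag (dilation UB (fun i => - pB i)) b).
    rewrite /rcdiag !cdiag_dilationB // add_block_mx !addr0 XE adjmxD !cdiag_adj.
    congr block_mx; congr (_ + _); apply: eq_cdiag => i; rewrite rmorphM /=;
      by congr (_ * _); apply: geC0_conj; rewrite ler0c.
  by rewrite -SE sub_add_sub; exact: psdD (psd_rcdiag _ a0) (psd_rcdiag _ b0).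
have xs i : x i <= s (lshift n i) by apply: (singular_value_le i uWx xd x0 XX uW sd s0 SX).
apply: (@le_trans _ _ (top_sum m (fun i => f (s i)))).
  (* The first [n] eigenvalues keep their indices; the terms of the others are nonnegative. *)
  rewrite /top_sum [leRHS]big_mkcond big_split_ord /= -!big_mkcond /=.
  apply: (@le_trans _ _ (\sum_(i < n | (i < m)%N) f (s (lshift n i)))).
    by apply: ler_sum => i _; apply: fmono.
  by rewrite lerDl; apply: sumr_ge0 => i _; apply: fge0.
rewrite -lecR; apply: le_trans (tr_concave_ge uJA uJB uW a0 b0 sd SE m fc f0) _.
have sq (J : 'M[C]_(n, n + n)) (c : 'I_n -> R) : (forall i, 0 <= c i) ->
    rcdiag J c = cdiag J (fun i => (Num.sqrt (c i))%:C * (Num.sqrt (c i))%:C).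
  by move=> c0; apply: eq_cdiag => i; rewrite -rmorphM -expr2 sqr_sqrtr.
rewrite !sq; try by move=> i; apply: fge0.
apply: (tr_dilation_le (m := m)) => // [i|i||G cG]; rewrite ?ler0c ?sqrtr_ge0 //.
  exact: top_proj_contraction.
apply: le_trans (tr_le_top_sum cG uU yd y0); rewrite -yE le_eqVlt; apply/orP; left.
apply/eqP; congr (\tr (_ *m (_ + _))); apply: eq_cdiag => i;
  by rewrite -rmorphM -expr2 sqr_sqrtr // fge0.
Qed.

End NormalMajorization.

(** * Reduction to a function vanishing at 0, and the norm inequality *)

Theorem theorem2p1 (R : realType) (n : nat) (A B : 'M[R[i]]_n)
  (f : R -> R) (N : 'M[R[i]]_n -> R) :
  A \is normalmx -> B \is normalmx ->
  nonneg_concave f -> symmetric_norm N ->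
  N (mfun f (absmx (A + B))) <= N (mfun f (absmx A) + mfun f (absmx B)).
Proof.
move=> nA nB fnc symN.
have [UA [pA [a [uA puA a0 AE AA]]]] := normal_polar nA.
have [UB [pB [b [uB puB b0 BE BB]]]] := normal_polar nB.
have fmono := nonneg_concave_homo fnc; have [fge0 fc] := fnc.
set X := A + B.
have [Wx [e [uWx ed XX]]] := hermitian_rcdiag (adjmx_gram X).
have e0 : forall i, 0 <= e i.
  by apply: (psd_rcdiag_ge0 uWx); rewrite -XX; apply: psd_gramr.
pose x i := Num.sqrt (e i).
have x0 i : 0 <= x i by apply: sqrtr_ge0.
have xd : decreasing_fun x by move=> i j ij; rewrite ler_wsqrtr // ed.
have {}XX : X ^t* *m X = rcdiag Wx (fun i => x i * x i).
  by rewrite XX; apply: eq_rcdiag => i; rewrite -expr2 sqr_sqrtr.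
rewrite (absmx_rcdiag uA a0 AA) (absmx_rcdiag uB b0 BB) (absmx_rcdiag uWx x0 XX).
rewrite !mfun_rcdiag // (norm_rcdiag symN _ uWx).
(* Restoring [f 0] adds it once to each left eigenvalue and twice to each right one, which helps
   because [f 0 >= 0]. *)
pose g t := f t - f 0.
have hZ : (rcdiag UA (fun i => g (a i)) + rcdiag UB (fun i => g (b i))) ^t* =
    rcdiag UA (fun i => g (a i)) + rcdiag UB (fun i => g (b i)).
  by rewrite adjmxD !rcdiag_adj.
have [U [y [uU yd ZE]]] := hermitian_rcdiag hZ.
have -> : rcdiag UA (fun i => f (a i)) + rcdiag UB (fun i => f (b i)) =
    rcdiag U (fun i => y i + (f 0 + f 0)).
  have split_g (V : 'M[R[i]]_n) (c : 'I_n -> R) : V \is unitarymx ->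
      rcdiag V (fun i => f (c i)) = rcdiag V (fun i => g (c i)) + (f 0)%:C%:M.
    move=> uV; rewrite -(cdiag_const _ uV) -/(rcdiag V (fun=> f 0)) rcdiagD.
    by apply: eq_rcdiag => i; rewrite /g subrK.
  rewrite !split_g // addrACA ZE -(cdiag_const _ uU) -/(rcdiag U (fun=> f 0)).
  by rewrite !rcdiagD.
rewrite (norm_rcdiag symN _ uU).
apply: dnorm_weakly_majorized => //.
- by move=> i j ij; apply: fmono; rewrite ?x0 ?xd.
- by move=> i; apply: fge0.
have gmaj : weakly_majorized (fun i => g (x i)) y.
  apply: (normal_concave_majorization uA uB puA puB a0 b0 _ uWx xd x0 XX uU yd ZE).
  - by rewrite /X -AE -BE.
  - by move=> u v t u0 v0 t0 t1; have := fc u v t u0 v0 t0 t1; rewrite /g; lra.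
  - exact: subrr.
  - by move=> t t0; rewrite subr_ge0 fmono.
  - by move=> t u t0 tu; rewrite lerD2r fmono.
move=> m; have -> : top_sum m (fun i => f (x i)) =
    top_sum m (fun i => g (x i)) + top_sum m (fun _ : 'I_n => f 0).
  by rewrite /top_sum -big_split; apply: eq_bigr => i _; rewrite /= /g subrK.
rewrite [leRHS]big_split; apply: lerD; first exact: gmaj.
by apply: ler_sum => i _; rewrite lerDl fge0.
Qed.
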